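(* Let $n,r\ge 1$ and let $p,q\ge 0$ be integers with $p+q\le n$. Then the normal form (all $x$'s to the left of all $\partial$'s) of the operator $M_{p,q}(Y)=\mathbf{D}^q(c_{p+q})(Y)$ on $\mathcal{P}(n,r)$, $Y\in\mathfrak{gl}_n$, is $$M_{p,q}(Y)=\sum_{\ell=0}^{q}(-1)^{q-\ell}(q-\ell)!\,\ell!\,S(q,\ell)\sum_{\substack{I_1,J_1\in\binom{[n]}{p}\\ I_2,J_2\in\binom{[n]}{q}\\ I_1\sqcup I_2=J_1\sqcup J_2}}\mathrm{sgn}\binom{I_1\ I_2}{J_1\ J_2}\det Y_{I_1J_1}\;\times\sum_{R\in\binom{[r]}{\ell}}\ \sum_{V,W\in\binom{[q]}{\ell}}\varepsilon\bigl(J_2,I_2,J_2(V),I_2(W)\bigr)\det\bigl(X_{J_2(V),R}\bigr)\det\bigl(D_{I_2(W),R}\bigr),$$ where $S(q,\ell)$ is the Stirling number of the second kind (the number of partitions of a $q$-element set into $\ell$ non-empty subsets).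
   Context: **Big algebra operators.** $\mathfrak{gl}_n$ has matrix units $E_{ij}$ and coordinates $y_{ij}$; $c_k(Y)$ is the sum of the principal $k\times k$ minors of $Y$ ($c_0=1$). $\mathcal{P}(n,r)=\mathbb{C}[\mathrm{Mat}(n,r)]=\mathbb{C}[x_{i\alpha}:1\le i\le n,1\le\alpha\le r]$, $\partial_{i\alpha}=\partial/\partial x_{i\alpha}$. $\mathfrak{gl}_n$ acts on $\mathcal{P}(n,r)$ by $L(E_{ij})=\sum_{\alpha=1}^r x_{i\alpha}\partial_{j\alpha}$. For polynomial maps $F:\mathfrak{gl}_n\to\mathrm{End}\,\mathcal{P}(n,r)$ the Kirillov--Wei operator is $(\mathbf{D}F)(Y)=\sum_{i,j=1}^n\frac{\partial F}{\partial y_{ji}}(Y)\cdot L(E_{ij})$; $c_k$ is identified with $Y\mapsto c_k(Y)\,\mathrm{Id}$. Put $M_{p,q}=\mathbf{D}^q(c_{p+q})$. **Matrices.** $X=[x_{i\alpha}]$ and $D=[\partial_{i\alpha}]$ are $n\times r$, $Y=[y_{ij}]$ is $n\times n$. For a matrix $M$ and tuples $I=(i_1,\dots,i_k)$, $J=(j_1,\dots,j_l)$, $M_{IJ}=[M_{i_aj_b}]_{a\in[k],b\in[l]}$. **Tuples and signs.** $[m]=\{1,\dots,m\}$; $\binom{[m]}{k}$ is the set of $k$-element subsets; $[m]^{\underline{k}}$ is the set of $k$-tuples of distinct elements of $[m]$. $\pi\in\mathfrak{S}_k$ acts on $k$-tuples by $\pi I=I\circ\pi^{-1}$, regarding $I$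 as a function on $[k]$. Whenever a subset is used as a tuple, an arbitrary ordering is chosen (the same one throughout a summand; summands do not depend on the choice). For $V\subset[q]$ and a $q$-tuple $J$, $J(V)$ is the subtuple of $J$ with positions in $V$. For $I,J\in[m]^{\underline{k}}$: $\mathrm{sgn}\binom{I}{J}=\mathrm{sgn}(\tau)$ if $I=J$ as sets, where $I=\tau J$, and $0$ otherwise. $\mathrm{sgn}\binom{I_1\ I_2}{J_1\ J_2}$ is $\mathrm{sgn}\binom{I}{J}$ for the concatenations $I=I_1I_2$, $J=J_1J_2$. For $I_1,J_1\in[m]^{\underline{a}}$ and $I_2,J_2\in[m]^{\underline{b}}$ with $a\ge b$: $\varepsilon(I_1,J_1,I_2,J_2)=\mathrm{sgn}(\tau_1\tau_2)$ if as sets $I_1\setminus I_2=J_1\setminus J_2$ and this set has exactly $a-b$ elements, and $0$ otherwise; here $\tau_1,\tau_2\in\mathfrak{S}_a$ are any permutations with $\tau_1I_1|_{[b]}=I_2$, $\tau_2J_1|_{[b]}=J_2$ and $\tau_1I_1|_{\{b+1,\dots,a\}}=\tau_2J_1|_{\{b+1,\dots,a\}}$ (the sign is independent of the choice). *)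

(* Defs.v *)
From HB Require Import structures.
From mathcomp Require Import all_boot all_order all_fingroup all_algebra.
From mathcomp Require Import boolp reals complex mpoly.

Set Implicit Arguments.
Unset Strict Implicit.
Unset Printing Implicit Defensive.

Import GRing.Theory.
Local Open Scope ring_scope.

(* The K-algebra of all K-linear endomorphisms of A, with composition as
   product: (f * g) v = f (g v). 'End(A) is only available when A is finite
   dimensional. A is taken to be a (nontrivial) algebra so that 1 != 0. *)
Definition endo (K : comNzRingType) (A : lalgType K) : Type := {linear A -> A}.

Section Endo.
Variables (K : comNzRingType) (A : lalgType K).
Implicit Types (f g h : endo A) (a b : K).

Definition endo_fun f : A -> A := GRing.Linear.sort f.

Definition mk_endo (f : A -> A) (fL : linear f) : endo A :=
  HB.pack_for {linear A -> A} f (GRing.isLinear.Build K A A *:%R f fL).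

Lemma endo_is_linear f : linear (endo_fun f).
Proof. exact: linearP. Qed.

Lemma endoP f g : endo_fun f =1 endo_fun g -> f = g.
Proof.
rewrite /endo_fun; case: f => f [[fD] [fZ]]; case: g => g [[gD] [gZ]] /= fg.
have {fg}efg : f = g by apply: funext.
subst g; congr (GRing.Linear.Pack (GRing.Linear.Class _ _)).
- by congr Algebra.isNmodMorphism.Axioms_; apply: Prop_irrelevance.
- by congr GRing.isScalable.Axioms_; apply: Prop_irrelevance.
Qed.

Fact endo0_subproof : linear (fun _ : A => 0 : A).
Proof. by move=> a u v; rewrite scaler0 addr0. Qed.
Fact endo1_subproof : linear (fun v : A => v).
Proof. by []. Qed.
Fact endo_add_subproof f g : linear (fun v => endo_fun f v + endo_fun g v).
Proof. by move=> a u v; rewrite !endo_is_linear scalerDr addrACA. Qed.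
Fact endo_opp_subproof f : linear (fun v => - endo_fun f v).
Proof. by move=> a u v; rewrite endo_is_linear opprD scalerN. Qed.
Fact endo_mul_subproof f g : linear (fun v => endo_fun f (endo_fun g v)).
Proof. by move=> a u v; rewrite !endo_is_linear. Qed.
Fact endo_scale_subproof a f : linear (fun v => a *: endo_fun f v).
Proof.
by move=> b u v; rewrite endo_is_linear scalerDr !scalerA mulrC.
Qed.

Definition endo0 := mk_endo endo0_subproof.
Definition endo1 := mk_endo endo1_subproof.
Definition endo_add f g := mk_endo (endo_add_subproof f g).
Definition endo_opp f := mk_endo (endo_opp_subproof f).
Definition endo_mul f g := mk_endo (endo_mul_subproof f g).
Definition endo_scale a f := mk_endo (endo_scale_subproof a f).

HB.instance Definition _ := gen_eqMixin (endo A).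
HB.instance Definition _ := gen_choiceMixin (endo A).

Fact endo_addA : associative endo_add.
Proof. by move=> f g h; apply: endoP => v; apply: addrA. Qed.
Fact endo_addC : commutative endo_add.
Proof. by move=> f g; apply: endoP => v; apply: addrC. Qed.
Fact endo_add0 : left_id endo0 endo_add.
Proof. by move=> f; apply: endoP => v; apply: add0r. Qed.
Fact endo_addN : left_inverse endo0 endo_opp endo_add.
Proof. by move=> f; apply: endoP => v; apply: addNr. Qed.

HB.instance Definition _ := GRing.isZmodule.Build (endo A)
  endo_addA endo_addC endo_add0 endo_addN.

Fact endo_mulA : associative endo_mul.
Proof. by move=> f g h; apply: endoP. Qed.
Fact endo_mul1l : left_id endo1 endo_mul.
Proof. by move=> f; apply: endoP. Qed.
Fact endo_mul1r : right_id endo1 endo_mul.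
Proof. by move=> f; apply: endoP. Qed.
Fact endo_mulDl : left_distributive endo_mul +%R.
Proof. by move=> f g h; apply: endoP. Qed.
Fact endo_mulDr : right_distributive endo_mul +%R.
Proof. by move=> f g h; apply: endoP => v; apply: (linearD f). Qed.
Fact endo_1neq0 : endo1 != 0.
Proof.
by apply/eqP => /(congr1 (fun f => endo_fun f 1)) /eqP; rewrite oner_eq0.
Qed.

HB.instance Definition _ := GRing.Zmodule_isNzRing.Build (endo A)
  endo_mulA endo_mul1l endo_mul1r endo_mulDl endo_mulDr endo_1neq0.

Fact endo_scaleA a b f :
  endo_scale a (endo_scale b f) = endo_scale (a * b) f.
Proof. by apply: endoP => v; apply: scalerA. Qed.
Fact endo_scale1 : left_id 1 endo_scale.
Proof. by move=> f; apply: endoP => v; apply: scale1r. Qed.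
Fact endo_scaleDr : right_distributive endo_scale +%R.
Proof. by move=> a f g; apply: endoP => v; apply: scalerDr. Qed.
Fact endo_scaleDl f : {morph endo_scale^~ f : a b / a + b}.
Proof. by move=> a b; apply: endoP => v; apply: scalerDl. Qed.

HB.instance Definition _ := GRing.Zmodule_isLmodule.Build K (endo A)
  endo_scaleA endo_scale1 endo_scaleDr endo_scaleDl.

Fact endo_scaleAl a f g : a *: (f * g) = a *: f * g.
Proof. by apply: endoP. Qed.

HB.instance Definition _ := GRing.Lmodule_isLalgebra.Build K (endo A)
  endo_scaleAl.

Fact endo_scaleAr a f g : a *: (f * g) = f * (a *: g).
Proof.
apply: endoP => v; rewrite [RHS]/endo_fun /=.
have f0 : endo_fun f 0 = 0 by apply: raddf0.
by have := endo_is_linear f a (endo_fun g v) 0; rewrite f0 !addr0 => ->.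
Qed.

HB.instance Definition _ := GRing.Lalgebra_isAlgebra.Build K (endo A)
  endo_scaleAr.

End Endo.

Section Operators.
Variables (K : comNzRingType) (n r : nat).

(* K[Mat(n, r)]: the coordinate x_(i, alpha) is the variable of index
   mxvec_index i alpha, where mxvec_index : 'I_n -> 'I_r -> 'I_(n * r) is
   bijective. The coordinates y_(i, j) of gl_n are indexed likewise. *)
Definition pol := {mpoly K[n * r]}.
HB.instance Definition _ := GRing.Lalgebra.on pol.

Fact xop_subproof (i : 'I_n) (a : 'I_r) :
  linear (fun f : pol => 'X_(mxvec_index i a) * f : pol).
Proof. by move=> c f g; rewrite mulrDr scalerAr. Qed.

Fact dop_subproof (i : 'I_n) (a : 'I_r) :
  linear (fun f : pol => f^`M(mxvec_index i a) : pol).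
Proof. by move=> c f g; rewrite linearP. Qed.

Definition Xmx : 'M[endo pol]_(n, r) :=
  \matrix_(i, a) mk_endo (xop_subproof i a).
Definition Dmx : 'M[endo pol]_(n, r) :=
  \matrix_(i, a) mk_endo (dop_subproof i a).

Definition Lop (i j : 'I_n) : endo pol := \sum_(a < r) Xmx i a * Dmx j a.

(* Polynomial maps gl_n -> End K[Mat(n, r)] are represented by polynomials in
   the y_(i, j) with coefficients in End K[Mat(n, r)]. *)
Definition polmap := {mpoly (endo pol)[n * n]}.

Definition polmap_eval (F : polmap) (Y : 'M[K]_n) : endo pol :=
  mmap idfun (fun k => (mxvec Y 0 k)%:A) F.

Definition kirillov_wei (F : polmap) : polmap :=
  \sum_(i < n) \sum_(j < n) F^`M(mxvec_index j i) * (Lop i j)%:MP.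

Definition Ymx : 'M[{mpoly K[n * n]}]_n := \matrix_(i, j) 'X_(mxvec_index i j).

Definition cminor (k : nat) : {mpoly K[n * n]} :=
  \sum_(A : {set 'I_n} | #|A| == k)
    \det (mxsub (@enum_val _ A) (@enum_val _ A) Ymx).

Definition Mop (p q : nat) : polmap :=
  iter q kirillov_wei (map_mpoly (in_alg (endo pol)) (cminor (p + q))).

End Operators.

Definition ksubset (m k : nat) := {A : {set 'I_m} | #|A| == k}.
HB.instance Definition _ m k := Finite.on (ksubset m k).

Section Tuples.
Variable m : nat.

Definition perm_act k (s : 'S_k) (I : k.-tuple 'I_m) : k.-tuple 'I_m :=
  [tuple tnth I ((s^-1)%g a) | a < k].

Definition subtuple q k (J : q.-tuple 'I_m) (V : k.-tuple 'I_q) : k.-tuple 'I_m :=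
  [tuple tnth J (tnth V a) | a < k].

(* For tuples without repetition, the permutation is unique, and it exists if
   and only if I and J are equal as sets. *)
Definition sgnt k (I J : k.-tuple 'I_m) : int :=
  if [pick t : 'S_k | I == perm_act t J] is Some t then (-1) ^+ t else 0.

Definition epst a b (I1 J1 : a.-tuple 'I_m) (I2 J2 : b.-tuple 'I_m) : int :=
  let I12 := [set i in I1] :\: [set i in I2] in
  let J12 := [set j in J1] :\: [set j in J2] in
  if (I12 == J12) && (#|I12| == a - b)%N then
    if [pick t : 'S_a * 'S_a |
         [&& take b (perm_act t.1 I1) == I2 :> seq _,
             take b (perm_act t.2 J1) == J2 :> seq _
           & drop b (perm_act t.1 I1) == drop b (perm_act t.2 J1)]] is Some t
    then (-1) ^+ (t.1 * t.2)%g else 0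
  else 0.

End Tuples.

Definition stirling2 (q l : nat) : nat :=
  #|[set P : {set {set 'I_q}} | partition P [set: 'I_q] & #|P| == l]|.

Definition submx_tuple (T : Type) m1 m2 k l (M : 'M[T]_(m1, m2))
    (I : k.-tuple 'I_m1) (J : l.-tuple 'I_m2) : 'M[T]_(k, l) :=
  mxsub (tnth I) (tnth J) M.

(* A choice, for every k-element subset of [m], of an arbitrary ordering of it;
   a k-tuple exhausting a set of cardinality k has no repetition. *)
Definition is_ordering (ord : forall m k, ksubset m k -> k.-tuple 'I_m) : Prop :=
  forall m k (A : ksubset m k), [set i in ord m k A] = val A.

(* Main.v *)
Require Import Defs.
From HB Require Import structures.
From mathcomp Require Import all_boot all_order all_fingroup all_algebra.
From mathcomp Require Import reals complex mpoly zify.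

Set Implicit Arguments.
Unset Strict Implicit.
Unset Printing Implicit Defensive.

Import GRing.Theory.
Local Open Scope ring_scope.

(* With the generalized Kronecker delta [kdelta], [c_m] is [1/m!] times the sum
   over [m]-tuples [w] of pairs of [kdelta (rows w) (columns w) * y_w], so each
   derivative moves one pair out of [y_w] while staying inside the delta, and
     [M_(p,q)(Y) = 1/p! \sum_(w, u) kdelta (w ++ u) y_w \prod_(e <- u) L(e)]
   with [w] a [p]-tuple and [u] a [q]-tuple of pairs.  Put the product of the
   [L(e)] in normal order from left to right. Multiplying a normally ordered
   product of [l] factors by a further [L(e)] either adds a factor, or contracts
   [e] with one of the [l] factors; antisymmetry of the delta turns each of these
   [l] contractions into minus the same sum with a diagonal pair [(c, c)] in the
   delta. This is the recurrence of the Stirling numbers, up to sign. It remains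
   to collect the tuples into subsets: sums of alternating functions against
   monomials are sums of minors over subsets, and [epst] is, up to [(q - l)!],
   the sum over [v] of the products of two deltas with common tail [v]. *)

(** * Stirling numbers of the second kind *)

Section Stirling.
Local Open Scope nat_scope.

(** Normal ordering produces the numbers through this recurrence; [stirling2E] identifies it with
    the count of partitions. *)
Fixpoint stirling_rec (q l : nat) : nat :=
  match q, l with
  | 0, 0 => 1
  | q'.+1, l'.+1 => stirling_rec q' l' + l * stirling_rec q' l
  | _, _ => 0
  end.

Variable T : finType.
Implicit Types (D B : {set T}) (P : {set {set T}}).

Definition partitions_of D l := [set P | partition P D & #|P| == l].

Lemma partition_notin_block P D B x :
  partition P D -> x \notin D -> B \in P -> x \notin B.
Proof. by move=> pP xD BP; apply: contra xD; apply/subsetP/(partitionS pP). Qed.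

Lemma notin_block_partition P D x :
  partition P D -> x \notin D -> [set x] \notin P.
Proof.
move=> pP xD; apply/negP => /(partition_notin_block pP xD).
by rewrite set11.
Qed.

(** Adjoining the block [[set x]] is a bijection onto these partitions, with deletion as inverse. *)
Lemma card_partitions_singleton D x l : x \notin D ->
  #|[set P in partitions_of (x |: D) l.+1 | [set x] \in P]|
  = #|partitions_of D l|.
Proof.
move=> xD; rewrite -[RHS](@card_in_imset _ _ (fun P => [set x] |: P)); last first.
  move=> P Q; rewrite !inE => /andP[pP _] /andP[pQ _] PQ.
  by rewrite -(setU1K (notin_block_partition pP xD)) PQ
             (setU1K (notin_block_partition pQ xD)).
congr #|pred_of_set _|; apply/setP => P; apply/idP/imsetP => [|[Q]].
  rewrite !inE => /andP[/andP[pP /eqP cP] xP].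
  exists (P :\ [set x]); last by rewrite setD1K.
  rewrite inE (_ : D = (x |: D) :\: [set x]); last by rewrite setU1K.
  by rewrite partitionD1 //= -eqSS -cP (cardsD1 [set x] P) xP.
rewrite !inE => /andP[pQ /eqP cQ] ->.
rewrite partitionU1 //; first last.
- by rewrite disjoints1.
- by apply/set0Pn; exists x; rewrite set11.
by rewrite cardsU1 (notin_block_partition pQ xD) cQ setU11 !eqxx.
Qed.

Definition add_to_block x P B := (x |: B) |: (P :\ B).

Lemma partition_add_to_block x D P B : x \notin D -> partition P D -> B \in P ->
  partition (add_to_block x P B) (x |: D).
Proof.
move=> xD pP BP; rewrite (_ : x |: D = (x |: B) :|: (D :\: B)); last first.
  rewrite -setUA; congr (_ :|: _).
  apply/setP => y; rewrite !inE; case: (boolP (y \in B)) => //= yB.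
  by rewrite (subsetP (partitionS pP BP)).
apply: partitionU1; first exact: partitionD1.
  by apply/set0Pn; exists x; rewrite setU11.
rewrite -setI_eq0; apply/eqP/setP => y; rewrite !inE.
by case: eqP => [->|_] /=; [rewrite (negPf xD) andbF | case: (y \in B)].
Qed.

Lemma pblock_add_to_block x D P B : x \notin D -> partition P D -> B \in P ->
  pblock (add_to_block x P B) x = x |: B.
Proof.
move=> xD pP BP; apply: def_pblock; rewrite ?setU11 //.
exact: partition_trivIset (partition_add_to_block xD pP BP).
Qed.

(** Each such partition arises exactly once by inserting [x] into one of the [l] blocks of a
    partition of [D]; the enlarged block is recovered as the one that contains [x]. *)
Lemma card_partitions_addition D x l : x \notin D ->
  #|[set P in partitions_of (x |: D) l | [set x] \notin P]|
  = l * #|partitions_of D l|.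
Proof.
move=> xD.
have nadd P B : partition P D -> B \in P -> x |: B \notin P :\ B.
  move=> pP BP; rewrite !inE negb_and; apply/orP; right; apply/negP => xBP.
  by have := partition_notin_block pP xD xBP; rewrite setU11.
(* Pairs of a partition of [D] and a chosen block: [l] choices per partition. *)
pose A := [set z : {set {set T}} * {set T} | (z.1 \in partitions_of D l) && (z.2 \in z.1)].
transitivity #|A|; last first.
  rewrite -sum1_card -sum1_card big_distrr /=.
  rewrite (eq_bigl (fun z => (z.1 \in partitions_of D l) && (z.2 \in z.1))); last first.
    by move=> z; rewrite inE.
  rewrite -(pair_big_dep (fun P => P \in partitions_of D l)
    (fun P B => B \in P) (fun _ _ => 1)).
  apply: eq_bigr => P; rewrite inE => /andP[_ /eqP <-].
  by rewrite sum1_card muln1.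
rewrite -(@card_in_imset _ _ (fun z => add_to_block x z.1 z.2) A); last first.
  case=> P B [Q C]; rewrite !inE /=.
  move=> /andP[/andP[pP _] BP] /andP[/andP[pQ _] CQ] eqPQ.
  have xB := partition_notin_block pP xD BP.
  have xC := partition_notin_block pQ xD CQ.
  have eB : x |: B = x |: C.
    by rewrite -(pblock_add_to_block xD pP BP) eqPQ (pblock_add_to_block xD pQ CQ).
  have {eB} eB : B = C by rewrite -(setU1K xB) eB setU1K.
  rewrite -eB in CQ eqPQ *; congr (_, _).
  rewrite -(setD1K BP) -(setD1K CQ); congr (_ |: _).
  by rewrite -(setU1K (nadd _ _ pP BP)) -(setU1K (nadd _ _ pQ CQ)); congr (_ :\ _).
congr #|pred_of_set _|; apply/setP => P; apply/idP/imsetP => [|[[Q B]]].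
  rewrite !inE => /andP[/andP[pP /eqP cP] xP].
  set B := pblock P x.
  have xcov : x \in cover P by rewrite (cover_partition pP) setU11.
  have BP : B \in P by apply: pblock_mem.
  have xB : x \in B by rewrite mem_pblock.
  have xBK : x |: (B :\ x) = B by rewrite setD1K.
  have pD : partition (P :\ B) (D :\: (B :\ x)).
    rewrite (_ : D :\: (B :\ x) = (x |: D) :\: B) ?partitionD1 //.
    apply/setP => y; rewrite !inE; case: (eqVneq y x) => [->|_] //=.
    by rewrite xB (negPf xD).
  (* Since [x] is not alone in its block, deleting it leaves a genuine block. *)
  have Bx0 : B :\ x != set0.
    apply: contra xP => /eqP B0; rewrite -(_ : B = [set x]) //.
    by rewrite -xBK B0 setU0.
  have sBD : B :\ x \subset D.
    apply/subsetP => y; rewrite !inE => /andP[yx yB].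
    by have := subsetP (partitionS pP BP) _ yB; rewrite !inE (negPf yx).
  have pQ : partition (B :\ x |: P :\ B) D.
    rewrite (_ : D = (B :\ x) :|: (D :\: (B :\ x))).
      apply: partitionU1 => //.
      rewrite -setI_eq0; apply/eqP/setP => y; rewrite !inE.
      by case: (y \in B); rewrite ?andbF //= ?andbT; case: eqP.
    by rewrite -{1}(setID D (B :\ x)) (setIidPr sBD).
  have BxP : B :\ x \notin P :\ B.
    apply/negP => BxP.
    have := partition_neq0 pD BxP.
    have /(partitionS pD) := BxP.
    move=> sB; case/set0Pn => y yB; have := subsetP sB _ yB.
    by rewrite inE yB.
  exists (B :\ x |: P :\ B, B :\ x).
    rewrite !inE /= eqxx pQ cardsU1 BxP /= andbT.
    by rewrite -cP (cardsD1 B P) BP.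
  by rewrite /add_to_block /= xBK setU1K // setD1K.
rewrite !inE /= => /andP[/andP[pQ /eqP cQ] BQ] ->.
rewrite partition_add_to_block //= cardsU1 nadd // (_ : (true : nat) + _ = l); last first.
  by rewrite -cQ (cardsD1 B Q) BQ.
rewrite eqxx /= /add_to_block !inE !negb_or negb_and (notin_block_partition pQ xD) orbT andbT.
apply/eqP => eB; have xB := partition_notin_block pQ xD BQ.
have : B = set0.
  by rewrite -(setU1K xB) -eB setDv.
by move=> B0; have := partition_neq0 pQ BQ; rewrite B0 eqxx.
Qed.

(** The recurrence comes from fixing [x] in [D] and asking whether [[set x]] is a block. *)
Lemma card_partitions D l : #|partitions_of D l| = stirling_rec #|D| l.
Proof.
elim: {D}#|D| {-2}D (erefl #|D|) l => [|q IHq] D cD l.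
  move/eqP: (cD); rewrite cards_eq0 => /eqP->; rewrite cards0.
  case: l => [|l] /=.
    rewrite -[RHS](cards1 (set0 : {set {set T}})); apply: eq_card => P.
    by rewrite !inE partition_set0; case: eqP => // ->; rewrite cards0.
  apply/eqP; rewrite cards_eq0; apply/eqP/setP => P.
  by rewrite !inE partition_set0; case: eqP => // ->; rewrite cards0.
have /set0Pn[x xD] : D != set0 by rewrite -cards_eq0 cD.
have eD : D = x |: (D :\ x) by rewrite setD1K.
have xD' : x \notin D :\ x by rewrite !inE eqxx.
have cD' : #|D :\ x| = q by move: cD; rewrite (cardsD1 x) xD => -[].
have split m : #|partitions_of D m| =
    #|[set P in partitions_of D m | [set x] \in P]|
    + #|[set P in partitions_of D m | [set x] \notin P]|.
  by rewrite -(cardsID [set P : {set {set T}} | [set x] \in P]); congr (_ + _);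
    apply: eq_card => P; rewrite !inE // andbC.
rewrite split cD eD card_partitions_addition // -eD.
case: l => [|l].
  rewrite mul0n addn0 /=; apply/eqP; rewrite cards_eq0; apply/eqP/setP => P.
  rewrite !inE; apply/negP => /andP[/andP[_]].
  by rewrite cards_eq0 => /eqP->; rewrite inE.
by rewrite {1}eD card_partitions_singleton // !IHq // cD'.
Qed.

End Stirling.

Lemma stirling2E q l : stirling2 q l = stirling_rec q l.
Proof.
have := card_partitions [set: 'I_q] l; rewrite cardsT card_ord => <-.
by apply: eq_card => P; rewrite !inE.
Qed.

(** * Alternating functions and generalized Kronecker deltas *)

(** Adjacent swaps bring the head of [s] to the front of [t]. The prefix [p] lets the induction
    continue behind the heads already matched. *)
Lemma perm_eq_swap_invariant (T : eqType) (V : Type) (F : seq T -> V) :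
  (forall s1 a b s2, F (s1 ++ a :: b :: s2) = F (s1 ++ b :: a :: s2)) ->
  forall s t, perm_eq s t -> F s = F t.
Proof.
move=> swapF s t; suff: forall p, perm_eq s t -> F (p ++ s) = F (p ++ t) by move/(_ [::]).
elim: s t => [|x s IHs] t p; first by rewrite perm_sym => /perm_nilP->.
move=> est; have : x \in t by rewrite -(perm_mem est) mem_head.
move=> xt; move: est; case/splitPr: xt => t1 t2 est.
rewrite -cat1s catA (IHs (t1 ++ t2)); last first.
  by rewrite -(perm_cons x); apply: perm_trans est _; rewrite perm_catC /= perm_cons perm_catC.
rewrite -catA /=; elim: t1 p {est} => [|y t1 IH] p //=.
by rewrite swapF -[p ++ y :: x :: _]cat_rcons IH cat_rcons.
Qed.

(** * Sums over tuples and the action of permutations *)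

Section TupleSums.
Variables (E : finType) (V : nmodType).

Lemma big_tuple0 (F : 0.-tuple E -> V) : \sum_(u : 0.-tuple E) F u = F [tuple].
Proof.
by apply: big_pred1 => u; apply/esym/eqP/tuple0.
Qed.

Lemma big_tupleS k (F : k.+1.-tuple E -> V) :
  \sum_(u : k.+1.-tuple E) F u
  = \sum_(e : E) \sum_(u : k.-tuple E) F [tuple of e :: u].
Proof.
rewrite pair_big /= (reindex (fun z : E * k.-tuple E => [tuple of z.1 :: z.2])) //=.
exists (fun u => (thead u, [tuple of behead u])) => [[e u] _|u _].
  by rewrite theadE; congr (_, _); apply: val_inj.
by rewrite [RHS]tuple_eta.
Qed.

End TupleSums.

(** The last entry is split off because iterated operators gain their new factor on the right. With
    [F] on sequences no casts between tuple types arise. *)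
Lemma big_tuple_rcons (E : finType) (V : nmodType) k (F : seq E -> V) :
  \sum_(u : k.+1.-tuple E) F u
  = \sum_(e : E) \sum_(u : k.-tuple E) F (rcons u e).
Proof.
elim: k F => [|k IHk] F.
  by rewrite big_tupleS; apply: eq_bigr => e _; rewrite !big_tuple0.
rewrite big_tupleS /= exchange_big /=.
rewrite exchange_big /=.
under eq_bigr => e _ do rewrite (IHk (fun u => F (e :: u))).
rewrite exchange_big; apply: eq_bigr => e _ /=.
by rewrite (big_tupleS (fun u : k.+1.-tuple E => F (rcons u e))).
Qed.

Lemma big_tuple_pair (T : finType) (V : nmodType) k (F : seq (T * T) -> V) :
  \sum_(u : k.-tuple (T * T)) F u
  = \sum_(a : k.-tuple T) \sum_(b : k.-tuple T) F (zip a b).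
Proof.
elim: k F => [|k IHk] F; first by rewrite !big_tuple0.
transitivity (\sum_(a : T) \sum_(b : T) \sum_(u : k.-tuple (T * T)) F ((a, b) :: u)).
  by rewrite big_tupleS [RHS]pair_big /=; apply: eq_bigr => -[].
rewrite big_tupleS; apply: eq_bigr => a _; under [RHS]eq_bigr do rewrite big_tupleS.
rewrite [RHS]exchange_big; apply: eq_bigr => b _ /=.
by rewrite (IHk (fun u => F ((a, b) :: u))).
Qed.

Section PermAct.
Variables (m k : nat).
Implicit Type I : k.-tuple 'I_m.

Lemma tnth_perm_act s I a : tnth (perm_act s I) a = tnth I (s^-1%g a).
Proof. exact: tnth_mktuple. Qed.

Lemma perm_act1 I : perm_act 1%g I = I.
Proof. by apply: eq_from_tnth => a; rewrite tnth_perm_act invg1 perm1. Qed.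

(** The product [s * t] applies [s] first. *)
Lemma perm_actM s t I : perm_act (s * t)%g I = perm_act t (perm_act s I).
Proof. by apply: eq_from_tnth => a; rewrite !tnth_perm_act invMg permM. Qed.

Lemma perm_actK s : cancel (@perm_act m k s) (perm_act s^-1%g).
Proof. by move=> I; rewrite -perm_actM mulgV perm_act1. Qed.

Lemma perm_eq_perm_act s I : perm_eq (perm_act s I) I.
Proof. by apply/tuple_permP; exists s^-1%g. Qed.

Lemma perm_eq_actP I J : reflect (exists s, I = perm_act s J) (perm_eq I J).
Proof.
apply: (iffP tuple_permP) => [[s eI]|[s ->]].
  exists s^-1%g; apply: val_inj; rewrite /= eI; congr (map _ _).
  by rewrite invgK.
by exists s^-1%g.
Qed.

End PermAct.

(** Stated for sequences, so that it passes to concatenations without casts. The size is fixed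
    because [kdelta] is meaningful only for sequences of equal size. *)
Definition swap_alternating (T : Type) (V : zmodType) k (F : seq T -> V) :=
  forall s1 a s2 b s3, size (s1 ++ a :: s2 ++ b :: s3) = k ->
  F (s1 ++ a :: s2 ++ b :: s3) = - F (s1 ++ b :: s2 ++ a :: s3).

Definition alternating (K : nzRingType) (V : lmodType K) m k
    (F : k.-tuple 'I_m -> V) :=
  forall s I, F (perm_act s I) = (-1) ^+ (s : bool) *: F I.

Lemma seq_split2 (T : Type) (s : seq T) x y : (x < y < size s)%N ->
  exists s1 a s2 b s3, [/\ s = s1 ++ a :: s2 ++ b :: s3, size s1 = x &
    (size s1 + size s2).+1 = y].
Proof.
move=> /andP[xy ys].
have xs := ltn_trans xy ys.
case: s => [//|a0 s0] in xs ys *; set s := a0 :: s0 in xs ys *.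
exists (take x s), (nth a0 s x), (drop x.+1 (take y s)), (nth a0 s y), (drop y.+1 s).
have sx : size (take x s) = x by rewrite size_takel // ltnW.
have sy : size (take y s) = y by rewrite size_takel // ltnW.
split=> //; last by rewrite size_drop sy sx; lia.
rewrite -{1}(cat_take_drop y s) (drop_nth a0 ys).
rewrite -{1}(cat_take_drop x (take y s)) take_takel; last exact: ltnW.
rewrite (@drop_nth _ a0 x (take y s)) ?sy // nth_take //.
by rewrite -catA.
Qed.

(** The filler [x0] at both marked places makes the last branch independent of [a] and [b], so
    sequences differing only there are easily compared. *)
Lemma nth_split2 (T : Type) (x0 : T) s1 a s2 b s3 i :
  nth x0 (s1 ++ a :: s2 ++ b :: s3) i =
  if i == size s1 then a else if i == (size s1 + size s2).+1 then b
  else nth x0 (s1 ++ x0 :: s2 ++ x0 :: s3) i.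
Proof.
rewrite !nth_cat; case: ltngtP => [lt1|gt1|->]; last by rewrite subnn.
  by case: eqP => // e; move: lt1; rewrite e -addnS -ltn_subRL subnn.
rewrite (_ : i - size s1 = (i - (size s1).+1).+1)%N /=; last by rewrite -subSn.
rewrite !nth_cat; case: (ltngtP (i - _) _) => [lt2|gt2|e2].
- by case: eqP => // e; move: lt2; rewrite e; lia.
- case: eqP => [e|_]; first by move: gt2; rewrite e; lia.
  by rewrite (_ : i - (size s1).+1 - size s2 = (i - (size s1).+2 - size s2).+1)%N //; lia.
- by rewrite e2 subnn (_ : _ == _); last by lia.
Qed.

Section Alternating.
Variables (K : nzRingType) (V : lmodType K) (m k : nat).

Lemma swap_alternating_tperm (F : seq 'I_m -> V) (I : k.-tuple 'I_m) (x y : 'I_k) :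
  swap_alternating k F -> x != y -> F (perm_act (tperm x y) I) = - F I.
Proof.
move=> altF; wlog xy : x y / (x < y)%N => [IH|].
  move=> nxy; case: (ltngtP x y) => [xy|yx|/val_inj exy]; first exact: IH.
    by rewrite tpermC IH // eq_sym.
  by rewrite exy eqxx in nxy.
move=> _; have : (x < y < size I)%N by rewrite xy size_tuple /=.
case/seq_split2 => [s1 [a [s2 [b [s3 [eI sx sy]]]]]].
have sk : size (s1 ++ a :: s2 ++ b :: s3) = k by rewrite -eI size_tuple.
have sk' : size (s1 ++ b :: s2 ++ a :: s3) = k.
  by move: sk; rewrite !size_cat /= !size_cat /=.
rewrite eI -altF //; congr F.
apply: (@eq_from_nth _ a) => [|i]; rewrite ?size_tuple ?sk' // => ik.
have -> : nth a (perm_act (tperm x y) I) i = nth a I (tperm x y (Ordinal ik)).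
  by rewrite -[(i)]/(nat_of_ord (Ordinal ik)) -tnth_nth tnth_perm_act tpermV -tnth_nth.
have sxy : (size s1 == (size s1 + size s2).+1) = false by lia.
rewrite eI [LHS]nth_split2 [RHS]nth_split2.
case: tpermP => [/(congr1 val) /= ->|/(congr1 val) /= ->|/eqP nx /eqP ny].
- by rewrite sy sx !eqxx gtn_eqF.
- by rewrite sy sx !eqxx gtn_eqF.
by rewrite /= sy sx; move: nx ny; rewrite -!(inj_eq val_inj) /= => /negPf-> /negPf->.
Qed.

Lemma swap_alternatingP (F : seq 'I_m -> V) :
  swap_alternating k F -> alternating (fun I : k.-tuple 'I_m => F I).
Proof.
move=> altF s; case: (prod_tpermP s) => ts -> dts I; rewrite odd_perm_prod //.
elim: ts dts I => [_ I|t ts IH /andP[dt dts] I].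
  by rewrite big_nil perm_act1 scale1r.
rewrite big_cons perm_actM IH // swap_alternating_tperm //= signrN.
by rewrite scalerN scaleNr.
Qed.

End Alternating.

Lemma swap_alternating_cat (T : Type) (V : zmodType) j k (F : seq T -> V) s1 s2 :
  swap_alternating k F -> (size s1 + (j + size s2))%N = k ->
  swap_alternating j (fun s => F (s1 ++ s ++ s2)).
Proof.
move=> altF ek t1 a t2 b t3 ej.
have := altF (s1 ++ t1) a t2 b (t3 ++ s2).
rewrite -!catA !cat_cons -!catA !cat_cons; apply.
move: ej ek; rewrite !size_cat /= !size_cat /= !size_cat; lia.
Qed.

Section KroneckerDelta.
Variables (K : comNzRingType) (T : eqType).
Implicit Types s t : seq T.

(* The generalized Kronecker delta: it is the sign of the permutation carrying
   t to s if both are repetition free with the same underlying set, and 0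
   otherwise. Sequences of different sizes give junk values. *)
Definition kdelta s t : K :=
  \det (\matrix_(a < size s, b < size s) (onth s a == onth t b)%:R).

Lemma kdeltaE k s t : size s = k ->
  kdelta s t = \det (\matrix_(a < k, b < k) (onth s a == onth t b)%:R).
Proof. by move=> <-. Qed.

Lemma kdeltaC s t : size s = size t -> kdelta s t = kdelta t s.
Proof.
move=> est; rewrite (kdeltaE t est) /kdelta -det_tr; congr (\det _).
by apply/matrixP => a b; rewrite !mxE eq_sym.
Qed.

Lemma onth_split2 s1 (a : T) s2 b s3 i :
  onth (s1 ++ a :: s2 ++ b :: s3) i =
  if i == size s1 then Some a else if i == (size s1 + size s2).+1 then Some b
  else onth (s1 ++ a :: s2 ++ a :: s3) i.
Proof.
rewrite !onthE !map_cat /= !map_cat /= nth_split2 !size_map.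
case: ifP => // i1; case: ifP => // i2.
by rewrite [RHS]nth_split2 !size_map i1 i2.
Qed.

(** Swapping two entries of [s] swaps two rows of the matrix. *)
Lemma kdelta_swapl k t : swap_alternating k (fun s => kdelta s t).
Proof.
move=> s1 a s2 b s3 sk.
have sk' : size (s1 ++ b :: s2 ++ a :: s3) = k.
  by move: sk; rewrite !size_cat /= !size_cat /=.
rewrite (kdeltaE t sk) (kdeltaE t sk').
have x_lt : (size s1 < k)%N by rewrite -sk !size_cat /=; lia.
have y_lt : ((size s1 + size s2).+1 < k)%N by rewrite -sk !size_cat /= size_cat /=; lia.
set x := Ordinal x_lt; set y := Ordinal y_lt.
have nxy : x != y by rewrite -(inj_eq val_inj) /=; lia.
set A := (X in \det X = _).
rewrite (_ : (\matrix_(_, _) _) = row_perm (tperm x y) A); last first.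
  apply/matrixP => i j; rewrite !mxE; congr (_ == _)%:R.
  rewrite [LHS]onth_split2 [RHS]onth_split2.
  case: tpermP => [->|->|/eqP nx /eqP ny] /=.
  - by rewrite eqxx eqxx gtn_eqF //=; lia.
  - by rewrite !eqxx gtn_eqF //=; lia.
  - move: nx ny; rewrite -!(inj_eq val_inj) /= => nx ny.
    rewrite (negPf nx) (negPf ny).
    by rewrite [RHS](onth_split2 s1 a s2 a) [LHS]onth_split2 (negPf nx) (negPf ny)
      !onthE !map_cat /= !map_cat /= nth_split2 [RHS]nth_split2 !size_map
      (negPf nx) (negPf ny).
by rewrite row_permE det_mulmx det_perm odd_tperm nxy mulN1r opprK.
Qed.

Lemma kdelta_swapr s : swap_alternating (size s) (fun t => kdelta s t).
Proof.
move=> s1 a s2 b s3 sk; have sk' : size (s1 ++ b :: s2 ++ a :: s3) = size s.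
  by rewrite -sk !size_cat /= !size_cat /=.
by rewrite !(kdeltaC (s := s)) //; apply: kdelta_swapl sk.
Qed.

(** The matrix is block upper triangular with an identity block in the upper left corner;
    [uniq (u ++ s)] makes the lower left block vanish. *)
Lemma kdelta_catl u s t : uniq (u ++ s) -> size s = size t ->
  kdelta (u ++ s) (u ++ t) = kdelta s t.
Proof.
move=> uus est; rewrite (kdeltaE _ (size_cat u s)).
rewrite (_ : (\matrix_(_, _) _) = block_mx 1%:M
  (\matrix_(a < size u, b < size s) (onth u a == onth t b)%:R)
  0 (\matrix_(a < size s, b < size s) (onth s a == onth t b)%:R)).
  by rewrite det_ublock det1 mul1r.
have neq_us i j : (i < size u)%N -> (j < size s)%N -> (onth s j == onth u i) = false.
  move=> iu js; move: uus; rewrite cat_uniq => /and3P[_ /hasPn us _].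
  case es : (onth s j) => [x|]; last first.
    by move: js; rewrite -onthTE es.
  apply/eqP => eu; have /us /= : x \in s by apply/onthP; exists j.
  by case/onthP; exists i.
have uu : uniq u by move: uus; rewrite cat_uniq => /and3P[].
apply/matrixP => i j; case: (split_ordP i) => {}i ->; case: (split_ordP j) => {}j ->.
- rewrite [LHS]mxE block_mxEul mxE /= !onth_cat !ltn_ord; congr ((nat_of_bool _)%:R : K).
  case: (eqVneq i j) => [->|nij]; first by rewrite eqxx.
  case eui : (onth u i) => [x|]; last by move: (ltn_ord i); rewrite -onthTE eui.
  case euj : (onth u j) => [y|]; last by move: (ltn_ord j); rewrite -onthTE euj.
  have := nth_uniq x (ltn_ord i) (ltn_ord j) uu.
  by rewrite (onth_nth x x _ _ eui) (onth_nth x y _ _ euj) (inj_eq val_inj) (negPf nij).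
- by rewrite [LHS]mxE block_mxEur mxE /= !onth_cat ltn_ord ltnNge leq_addr addKn.
- by rewrite [LHS]mxE block_mxEdl mxE /= !onth_cat ltn_ord ltnNge leq_addr addKn /= neq_us.
- by rewrite [LHS]mxE block_mxEdr mxE /= !onth_cat !ltnNge !leq_addr !addKn.
Qed.

End KroneckerDelta.

Section KroneckerTuple.
Variables (K : comNzRingType) (m k : nat).
Implicit Types I J : k.-tuple 'I_m.

Lemma perm_act_inj I s t : uniq I -> perm_act s I = perm_act t I -> s = t.
Proof.
move=> /tuple_uniqP injI est; apply: invg_inj; apply/permP => a; apply: injI.
by rewrite -!tnth_perm_act est.
Qed.

(** In the Leibniz expansion each product of entries is the indicator of one rearrangement;
    inverting the summation index matches the convention of [perm_act]. *)
Lemma kdelta_sumE I J :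
  kdelta K I J = \sum_(s : 'S_k) (-1) ^+ s * (I == perm_act s J)%:R.
Proof.
rewrite (kdeltaE _ _ (size_tuple I)) /determinant (reindex_inj invg_inj) /=.
apply: eq_bigr => s _; rewrite odd_permV; congr (_ * _).
transitivity (\prod_a (tnth I a == tnth J (s^-1%g a))%:R : K).
  apply: eq_bigr => a _; rewrite mxE; congr ((nat_of_bool _)%:R : K).
  have onth_tnth (L : k.-tuple 'I_m) (b : 'I_k) : onth L b = Some (tnth L b).
    by apply/tnth_onth.
  by rewrite !onth_tnth.
case: (I =P _) => [->|ne].
  by rewrite big1 // => a _; rewrite tnth_perm_act eqxx.
have [a /negPf na] : exists a, tnth I a != tnth J (s^-1%g a).
  apply/existsP; rewrite -negb_forall; apply/negP => /forallP eIJ.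
  by apply: ne; apply: eq_from_tnth => a; rewrite tnth_perm_act; apply/eqP.
by rewrite (bigD1 a) //= na mul0r.
Qed.

Lemma kdeltaxx I : uniq I -> kdelta K I I = 1.
Proof.
move=> uI; rewrite kdelta_sumE (bigD1 1%g) //= perm_act1 eqxx odd_perm1 mulr1.
rewrite big1 ?addr0 // => s s1; case: eqP => [e|]; last by rewrite mulr0.
by rewrite -(perm_act_inj uI (etrans (perm_act1 I) e)) eqxx in s1.
Qed.

Lemma kdelta_neq0 I J : kdelta K I J != 0 -> exists s, I = perm_act s J.
Proof.
rewrite kdelta_sumE => nz; apply/perm_eq_actP; apply: contraNT nz => nIJ.
rewrite big1 // => s _; case: eqP => [e|]; last by rewrite mulr0.
by case/negP: nIJ; rewrite e perm_eq_perm_act.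
Qed.

Lemma kdelta_altl J : alternating (fun I => kdelta K I J : K^o).
Proof. exact: (swap_alternatingP (V := K^o) (@kdelta_swapl K _ k J)). Qed.

Lemma kdelta_altr I : alternating (fun J => kdelta K I J : K^o).
Proof.
have := @kdelta_swapr K _ I; rewrite size_tuple => altI.
exact: (swap_alternatingP (V := K^o) altI).
Qed.

Lemma kdelta_perml s I J : kdelta K (perm_act s I) J = (-1) ^+ s * kdelta K I J.
Proof. exact: kdelta_altl. Qed.

End KroneckerTuple.

(** * From sums over tuples to sums over subsets *)

Section SubsetSums.
Variables (m k : nat) (ord : ksubset m k -> k.-tuple 'I_m).
Hypothesis ordP : forall A, [set i in ord A] = val A.

Lemma ord_uniq A : uniq (ord A).
Proof.
apply/card_uniqP; rewrite size_tuple; transitivity #|val A|; last exact/eqP/(valP A).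
by rewrite -ordP; apply: eq_card => i; rewrite inE.
Qed.

(** A repetition-free tuple is a unique rearrangement of the chosen ordering of its set of
    entries. *)
Lemma big_uniq_tuple (V : nmodType) (F : k.-tuple 'I_m -> V) :
  (forall I : k.-tuple 'I_m, ~~ uniq I -> F I = 0) ->
  \sum_(I : k.-tuple 'I_m) F I = \sum_A \sum_(s : 'S_k) F (perm_act s (ord A)).
Proof.
move=> F0.
transitivity (\sum_(A : ksubset m k)
    \sum_(I : k.-tuple 'I_m | uniq I && ([set i in I] == val A)) F I).
  rewrite (exchange_big_dep xpredT) //=; apply: eq_bigr => I _.
  case: (boolP (uniq I)) => [uI|nI]; last by rewrite F0 // big_pred0.
  have cI : #|[set i in I]| == k.
    by rewrite cardsE (card_uniqP uI) size_tuple.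
  rewrite (big_pred1 (Sub [set i in I] cI : ksubset m k)) // => A /=.
  by rewrite -(inj_eq val_inj) /= eq_sym.
apply: eq_bigr => A _.
transitivity (\sum_(I in [set perm_act s (ord A) | s in [set: 'S_k]]) F I); last first.
  rewrite big_imset /=; first by apply: eq_bigl => s; rewrite inE.
  by move=> s t _ _; apply/perm_act_inj/ord_uniq.
apply: eq_bigl => I; apply/andP/imsetP => [[uI /eqP sI]|[s _ ->]].
  have /perm_eq_actP[s ->] : perm_eq I (ord A); last by exists s.
  apply: uniq_perm => //; first exact: ord_uniq.
  by move=> i; rewrite -[LHS]in_set sI -ordP inE.
rewrite (perm_uniq (perm_eq_perm_act _ _)) ord_uniq -ordP; split=> //.
by apply/eqP/setP => i; rewrite !inE (perm_mem (perm_eq_perm_act _ _)).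
Qed.

Lemma big_symmetric_tuple (V : nmodType) (F : k.-tuple 'I_m -> V) :
  (forall I : k.-tuple 'I_m, ~~ uniq I -> F I = 0) -> (forall s I, F (perm_act s I) = F I) ->
  \sum_I F I = (\sum_A F (ord A)) *+ k`!.
Proof.
move=> F0 Fs; rewrite big_uniq_tuple // -sumrMnl; apply: eq_bigr => A _.
under eq_bigr do rewrite Fs.
by rewrite sumr_const card_Sn.
Qed.

End SubsetSums.

Section Det.
Variables (K : comNzRingType) (R : algType K) (m r : nat) (M : 'M[R]_(m, r)).
Hypothesis commM : forall i a j b, M i a * M j b = M j b * M i a.

Lemma prod_reindex_comm k (f : 'I_k -> R) (s : 'S_k) :
  (forall a b, f a * f b = f b * f a) -> \prod_a f (s a) = \prod_a f a.
Proof.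
move=> fC; transitivity (\prod_(a <- map s (index_enum 'I_k)) f a).
  by rewrite big_map.
apply: (perm_eq_swap_invariant (F := fun l => \prod_(a <- l) f a)) => [s1 a b s2|].
  by rewrite !big_cat /= !big_cons /=; congr (_ * _); rewrite !mulrA fC.
apply: uniq_perm; rewrite ?(map_inj_uniq (@perm_inj _ s)) ?index_enum_uniq //.
move=> a; rewrite mem_index_enum -[a](permKV s) map_f ?mem_index_enum //.
Qed.

(** The algebra [R] need not be commutative, but the entries of [M] commute. Hence the factors can
    be reordered, which moves the permutation from the columns to the rows [b]. *)
Lemma det_submx_tupleE k (b : k.-tuple 'I_m) (c : k.-tuple 'I_r) :
  \det (submx_tuple M b c) =
  \sum_(s : 'S_k) (-1) ^+ s *: \prod_a M (tnth (perm_act s b) a) (tnth c a).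
Proof.
apply: eq_bigr => s _; rewrite mulr_sign -scaler_sign; congr (_ *: _).
rewrite -[LHS](prod_reindex_comm s^-1%g) => [|i j]; last by rewrite !mxE commM.
by apply: eq_bigr => a _; rewrite !mxE tnth_perm_act permKV.
Qed.

Lemma det_submx_tuple_altl k (c : k.-tuple 'I_r) :
  alternating (fun b => \det (submx_tuple M b c)).
Proof.
move=> t b; rewrite !det_submx_tupleE scaler_sumr.
rewrite [RHS](reindex_inj (mulgI t)); apply: eq_bigr => s _ /=.
by rewrite scalerA odd_permM signr_addb mulrA -signr_addb addbb mul1r perm_actM.
Qed.

Lemma det_submx_tuple_altr k (b : k.-tuple 'I_m) :
  alternating (fun c => \det (submx_tuple M b c)).
Proof.
move=> t c; rewrite /determinant scaler_sumr.
rewrite [LHS](reindex_inj (mulIg t)); apply: eq_bigr => s _ /=.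
rewrite odd_permM addbC signr_addb -mulrA mulr_sign -scaler_sign.
congr (_ *: (_ * _)); apply: eq_bigr => a _.
by rewrite !mxE tnth_perm_act permM permK.
Qed.
End Det.

Section AlternatingSums.
Variables (K : numFieldType) (V : lmodType K) (m k : nat).
Variables (F : k.-tuple 'I_m -> V).
Hypothesis altF : alternating F.

(** A transposition of two equal entries fixes [I], so [F I = - F I], and the characteristic is
    zero. *)
Lemma alternating_notuniq (I : k.-tuple 'I_m) : ~~ uniq I -> F I = 0.
Proof.
move=> nuI; have : ~~ injectiveb (tnth I).
  by apply: contra nuI => /injectiveP ?; apply/tuple_uniqP.
case/injectivePn => a [b nab eab].
have := altF (tperm a b) I; rewrite odd_tperm nab expr1 scaleN1r.
rewrite (_ : perm_act _ I = I); last first.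
  apply: eq_from_tnth => c; rewrite tnth_perm_act tpermV.
  by case: tpermP => [->|->|].
move=> /eqP; rewrite -addr_eq0 -mulr2n -scaler_nat scaler_eq0 Num.Theory.pnatr_eq0 /=.
by move/eqP.
Qed.

(** After expansion of the delta, each permutation [s] selects the tuple [perm_act s L], and the two
    signs cancel. *)
Lemma sum_kdelta_alternating_tuple (L : k.-tuple 'I_m) :
  \sum_(I : k.-tuple 'I_m) kdelta K I L *: F I = F L *+ k`!.
Proof.
under eq_bigr do rewrite kdelta_sumE scaler_suml.
rewrite exchange_big /=.
transitivity (\sum_(s : 'S_k) F L); last by rewrite sumr_const card_Sn.
apply: eq_bigr => s _; rewrite (bigD1 (perm_act s L)) //= eqxx mulr1.
rewrite big1 ?addr0 => [|I /negPf nI]; last by rewrite nI mulr0 scale0r.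
by rewrite altF scalerA -signr_addb addbb scale1r.
Qed.

Variables (ord : ksubset m k -> k.-tuple 'I_m).
Hypothesis ordP : forall A, [set i in ord A] = val A.

(** The delta is a reproducing kernel for alternating functions: the factor [k!] of the sum over
    tuples is the number of orderings of a subset. *)
Lemma sum_kdelta_alternating (L : k.-tuple 'I_m) :
  \sum_A kdelta K (ord A) L *: F (ord A) = F L.
Proof.
have kn0 : k`!%:R != 0 :> K by rewrite Num.Theory.pnatr_eq0 -lt0n fact_gt0.
apply: (scalerI kn0); rewrite !scaler_nat -sum_kdelta_alternating_tuple.
symmetry; apply: (big_symmetric_tuple ordP (F := fun I => kdelta K I L *: F I)).
  by move=> I nI; rewrite alternating_notuniq // scaler0.
by move=> s I; rewrite altF kdelta_perml scalerA mulrAC -signr_addb addbb mul1r.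
Qed.
End AlternatingSums.

Section AlternatingProducts.
Variables (K : numFieldType) (R : algType K) (m r k : nat) (M : 'M[R]_(m, r)).
Hypothesis commM : forall i a j b, M i a * M j b = M j b * M i a.
Variables (ord : ksubset m k -> k.-tuple 'I_m).
Hypothesis ordP : forall A, [set i in ord A] = val A.

(** The rearrangements of one subset, with the signs given by [F], form the Leibniz expansion of a
    minor. *)
Lemma sum_alternating_prod (F : k.-tuple 'I_m -> K) (c : k.-tuple 'I_r) :
  alternating (F : _ -> K^o) ->
  \sum_b F b *: \prod_a M (tnth b a) (tnth c a)
  = \sum_B F (ord B) *: \det (submx_tuple M (ord B) c).
Proof.
move=> altF; rewrite (big_uniq_tuple ordP) => [|I nI]; last first.
  by rewrite (alternating_notuniq altF nI) scale0r.
apply: eq_bigr => B _; rewrite det_submx_tupleE // scaler_sumr.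
by apply: eq_bigr => s _; rewrite altF scalerA mulrC.
Qed.

End AlternatingProducts.

(** * Normal ordering *)

Lemma stirling_rec_small q l : (q < l)%N -> stirling_rec q l = 0%N.
Proof.
elim: q l => [|q IHq] [|l] //= ql.
by rewrite !IHq ?muln0 // ltnW.
Qed.

Definition diag_pairs (T : Type) (v : seq T) := [seq (c, c) | c <- v].

(** What normal ordering uses of the delta, for pairs of a row and a column. The exchange of rows at
    the head is enough, since any two pairs can be moved there. *)
Record pair_alternating (T : eqType) (V : zmodType) (Phi : seq (T * T) -> V) := {
  pair_alternating_perm : forall s t, perm_eq s t -> Phi s = Phi t;
  pair_alternating_swap : forall a b c d s,
    Phi ((a, b) :: (c, d) :: s) = - Phi ((c, b) :: (a, d) :: s) }.

Lemma pair_alternating_cons (T : eqType) (V : zmodType) (Phi : seq (T * T) -> V) e :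
  pair_alternating Phi -> pair_alternating (fun s => Phi (e :: s)).
Proof.
case=> permPhi swapPhi; split=> [s t est|a b c d s].
  by apply: permPhi; rewrite perm_cons.
rewrite (permPhi _ ((a, b) :: (c, d) :: e :: s)); last first.
  by rewrite -(perm_catCA [:: (a, b); (c, d)] [:: e] s).
rewrite swapPhi; congr (- _); apply: permPhi.
by rewrite (perm_catCA [:: (c, b); (a, d)] [:: e] s).
Qed.

Lemma pair_alternating_catr (T : eqType) (V : zmodType) (Phi : seq (T * T) -> V) w :
  pair_alternating Phi -> pair_alternating (fun s => Phi (s ++ w)).
Proof.
case=> permPhi swapPhi; split=> [s t est|a b c d s]; last exact: swapPhi.
by apply: permPhi; rewrite perm_cat2r.
Qed.

Section NormalOrdering.
Variables (K : comNzRingType) (R : algType K) (n r : nat) (X D : 'M[R]_(n, r)).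
Hypothesis commD : forall i a j b, D i a * D j b = D j b * D i a.
Hypothesis commDX : forall i a j b,
  D i a * X j b = X j b * D i a + ((i == j) && (a == b))%:R.
Local Notation T := 'I_n.

(* The pair [e = (i, j)] stands for the coordinate [y_ij], whose derivative comes
   with the operator [L(E_ji)]: hence the swapped indices. *)
Definition polarization (e : T * T) : R := \sum_a X e.2 a * D e.1 a.

(** Each pair wraps its [X] and [D] around the product of the later pairs, so all [X] stand to the
    left of all [D], the latter in reverse order. *)
Fixpoint normal_product (u : seq (T * T)) : R :=
  if u is e :: u' then \sum_a X e.2 a * normal_product u' * D e.1 a else 1.

Lemma commD_polarization i a e :
  D i a * polarization e = polarization e * D i a + (i == e.2)%:R * D e.1 a.
Proof.
rewrite /polarization mulr_sumr mulr_suml.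
transitivity (\sum_b (X e.2 b * D e.1 b * D i a + ((i == e.2) && (a == b))%:R * D e.1 b)).
  apply: eq_bigr => b _.
  by rewrite mulrA commDX mulrDl -!mulrA [D i a * _]commD.
rewrite big_split /=; congr (_ + _).
rewrite (bigD1 a) //= eqxx andbT big1 ?addr0 // => b /negPf nb.
by rewrite [a == b]eq_sym nb andbF mul0r.
Qed.

(** Induction on [l], peeling off the outer factor [f]. Its [D] either passes [e] or contracts with
    it, which requires [f.1 = e.2] and leaves the pair [(e.1, f.2)]. Antisymmetry turns the pairs
    [(e.1, c)] and [(c, f.2)] in [Phi] into [(c, c)] and [(e.1, f.2)] with a minus sign, so all
    contractions yield the same sum. *)
Lemma sum_normal_product_mul (Phi : seq (T * T) -> K) l : pair_alternating Phi ->
  \sum_(e : T * T) \sum_(u : l.-tuple (T * T))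
     Phi (e :: u) *: (normal_product u * polarization e)
  = \sum_(u : l.+1.-tuple (T * T)) Phi u *: normal_product u
    - (\sum_(c : T) \sum_(u : l.-tuple (T * T)) Phi ((c, c) :: u) *: normal_product u) *+ l.
Proof.
elim: l Phi => [|l IHl] Phi altPhi.
  rewrite mulr0n subr0 big_tupleS; apply: eq_bigr => e _.
  rewrite !big_tuple0 /= mul1r; congr (_ *: _).
  by apply: eq_bigr => a _; rewrite mulr1.
have permPhi := pair_alternating_perm altPhi.
(* [S f a] wraps an operator in the [a]-th term of the factor [f]. *)
pose S f a (x : R) := X (f : T * T).2 a * x * D f.1 a.
have stepE e f (u : seq (T * T)) :
    normal_product (f :: u) * polarization e =
    \sum_a S f a (normal_product u * polarization e)
    + (f.1 == e.2)%:R * normal_product ((e.1, f.2) :: u).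
  rewrite /= mulr_suml [X in _ = _ + X]mulr_sumr -big_split; apply: eq_bigr => a _ /=.
  rewrite -mulrA commD_polarization mulrDr /S; congr (_ + _); first by rewrite !mulrA.
  by rewrite !mulr_natl mulrnAr.
transitivity (\sum_(f : T * T) \sum_a S f a (\sum_(e : T * T) \sum_(u : l.-tuple (T * T))
     Phi (f :: e :: u) *: (normal_product u * polarization e))
   + \sum_(e : T * T) \sum_(f : T * T) \sum_(u : l.-tuple (T * T))
     ((f.1 == e.2)%:R * Phi (e :: f :: u)) *: normal_product ((e.1, f.2) :: u)).
  under eq_bigr do rewrite big_tupleS.
  under [X in X + _]eq_bigr do under eq_bigr do rewrite /S mulr_sumr mulr_suml.
  under [X in X + _]eq_bigr do rewrite exchange_big.
  rewrite [X in X + _]exchange_big -big_split; apply: eq_bigr => e _ /=.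
  rewrite -big_split; apply: eq_bigr => f _ /=.
  under [X in X + _]eq_bigr do rewrite mulr_sumr mulr_suml.
  rewrite [X in X + _]exchange_big -big_split; apply: eq_bigr => u _ /=.
  rewrite stepE scalerDr; congr (_ + _); last first.
    by case: eqP => _; rewrite ?mul0r ?scale0r ?scaler0 // !mul1r.
  rewrite scaler_sumr; apply: eq_bigr => a _.
  rewrite /S -scalerAr -scalerAl (permPhi (e :: f :: u) (f :: e :: u)) //.
  by rewrite (perm_catCA [:: e] [:: f] u).
(* The induction hypothesis is applied inside the wrapping, to [Phi] with [f] in front. *)
under eq_bigr => f _.
  under eq_bigr => a _.
    rewrite (IHl _ (pair_alternating_cons f altPhi)).
    rewrite /S mulrBr mulrBl mulrnAr mulrnAl.
    rewrite big_distrr big_distrl big_distrr big_distrl /=.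
    over.
  rewrite sumrB; over.
(* Of the [l.+1] contraction terms, [l] come from the induction hypothesis and one from the outer
   factor. *)
rewrite sumrB mulrSr opprD addrA; congr (_ - _ + _).
- rewrite (big_tupleS (fun u : l.+2.-tuple (T * T) => Phi u *: normal_product u)).
  apply: eq_bigr => f _; rewrite exchange_big; apply: eq_bigr => u _ /=.
  by rewrite scaler_sumr; apply: eq_bigr => a _; rewrite -scalerAr -scalerAl.
- under eq_bigr do rewrite sumrMnl.
  rewrite sumrMnl; congr (_ *+ _).
  under [RHS]eq_bigr do rewrite big_tupleS.
  rewrite [RHS]exchange_big; apply: eq_bigr => f _ /=.
  rewrite exchange_big; apply: eq_bigr => c _ /=.
  under eq_bigr do rewrite mulr_sumr mulr_suml.
  rewrite exchange_big; apply: eq_bigr => u _ /=.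
  rewrite scaler_sumr; apply: eq_bigr => a _.
  rewrite -scalerAr -scalerAl (permPhi ((c, c) :: f :: u) (f :: (c, c) :: u)) //.
  by rewrite (perm_catCA [:: (c, c)] [:: f] u).
(* Here [e = (i, d)] and [f = (c, j)]; contraction forces [c = d]. *)
pose G i c d j := \sum_(u : l.-tuple (T * T))
  ((c == d)%:R * Phi ((i, d) :: (c, j) :: u)) *: normal_product ((i, j) :: u).
transitivity (\sum_i \sum_d \sum_c \sum_j G i c d j).
  rewrite [RHS]pair_big /=; apply: eq_bigr => -[i d] _ /=.
  by rewrite [RHS]pair_big /=; apply: eq_bigr => -[c j] _ /=.
transitivity (\sum_i \sum_d \sum_j G i d d j).
  apply: eq_bigr => i _; apply: eq_bigr => d _.
  rewrite (bigD1 d) //= [X in _ + X]big1 ?addr0 // => c /negPf cd.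
  by rewrite big1 // => j _; rewrite /G big1 // => u _; rewrite cd mul0r scale0r.
rewrite exchange_big -sumrN; apply: eq_bigr => c _ /=.
rewrite big_tupleS -sumrN [LHS]pair_big /=; apply: eq_bigr => -[i j] _.
rewrite /G -sumrN; apply: eq_bigr => u _.
rewrite eqxx mul1r (pair_alternating_swap altPhi) scaleNr.
by [].
Qed.

(** Induction on [q], splitting off the last factor. Every contraction costs one factor and leaves
    one diagonal pair in [Phi], so [l] surviving factors come with [q - l] diagonal pairs. *)
Lemma normal_ordering (Phi : seq (T * T) -> K) q : pair_alternating Phi ->
  \sum_(u : q.-tuple (T * T)) Phi u *: \prod_(e <- u) polarization e =
  \sum_(l < q.+1) ((-1) ^+ (q - l) * (stirling_rec q l)%:R) *:
    \sum_(u : l.-tuple (T * T)) \sum_(v : (q - l).-tuple T)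
      Phi (u ++ diag_pairs v) *: normal_product u.
Proof.
elim: q Phi => [|q IHq] Phi altPhi.
  by rewrite big_ord1 !big_tuple0 /= big_nil subnn expr0 mulr1 scale1r.
have permPhi := pair_alternating_perm altPhi.
pose A l m := \sum_(u : l.-tuple (T * T)) \sum_(v : m.-tuple T)
  Phi (u ++ diag_pairs v) *: normal_product u.
pose c q l : K := (-1) ^+ (q - l) * (stirling_rec q l)%:R.
(* The new factor is either kept or, in [l] equal ways and with a minus sign, turned into a diagonal
   pair. *)
transitivity (\sum_(l < q.+1) c q l *: (A l.+1 (q - l)%N - A l (q - l).+1 *+ l)).
  rewrite (big_tuple_rcons _ (fun u => Phi u *: \prod_(e <- u) polarization e)).
  transitivity (\sum_e (\sum_(u : q.-tuple (T * T))
      Phi (e :: u) *: \prod_(f <- u) polarization f) * polarization e).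
    apply: eq_bigr => e _; rewrite mulr_suml; apply: eq_bigr => u _.
    by rewrite -scalerAl big_rcons (permPhi _ (e :: u)) ?perm_rcons.
  under eq_bigr => f _.
    rewrite (IHq _ (pair_alternating_cons f altPhi)).
    rewrite mulr_suml; over.
  rewrite exchange_big; apply: eq_bigr => l _ /=.
  under eq_bigr do rewrite -scalerAl.
  rewrite -scaler_sumr; congr (_ *: _).
  transitivity (\sum_(v : (q - l).-tuple T) \sum_(e : T * T) \sum_(u : l.-tuple (T * T))
      Phi (e :: u ++ diag_pairs v) *: (normal_product u * polarization e)).
    rewrite exchange_big; apply: eq_bigr => e _; rewrite mulr_suml exchange_big /=.
    apply: eq_bigr => u _; rewrite mulr_suml; apply: eq_bigr => v _.
    by rewrite scalerAl.
  under eq_bigr => v _.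
    rewrite (sum_normal_product_mul _ (pair_alternating_catr _ altPhi)); over.
  rewrite sumrB sumrMnl; congr (_ - _ *+ _); first by rewrite exchange_big.
  rewrite /A; under [RHS]eq_bigr do rewrite big_tupleS.
  rewrite [RHS]exchange_big [LHS]exchange_big; apply: eq_bigr => d _ /=.
  rewrite exchange_big; apply: eq_bigr => u _; apply: eq_bigr => v _ /=; congr (_ *: _).
  apply: permPhi; rewrite perm_sym.
  by apply: (permEl (perm_catCA u [:: (d, d)] (diag_pairs v))).
(* The Stirling recurrence with signs. For [l = q] the exponent [q - l.+1] is truncated, but there
   the Stirling number vanishes. *)
have cS l : (l <= q)%N -> c q.+1 l.+1 = c q l - c q l.+1 *+ l.+1.
  rewrite /c subSS leq_eqVlt => /predU1P[->|lq].
    by rewrite /= (stirling_rec_small (ltnSn q)) muln0 addn0 mulr0 mul0rn subr0.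
  rewrite /= natrD natrM mulrDr -(subnSK lq) exprS mulN1r !mulNr; congr (_ - _).
  by rewrite mulrCA mulr_natl.
(* The boundary values allow both sums to be shifted to a common range. *)
have c0 : c q.+1 0%N = 0 by rewrite /c /= mulr0.
have cq : c q q.+1 = 0 by rewrite /c stirling_rec_small // mulr0.
under eq_bigr do rewrite scalerBr.
rewrite sumrB [RHS](eq_bigr (fun l : 'I_q.+2 => c q.+1 l *: A l (q.+1 - l)%N)) //.
rewrite [RHS]big_ord_recl c0 scale0r add0r.
rewrite [RHS](eq_bigr (fun l : 'I_q.+1 => c q l *: A l.+1 (q - l)%N
    - c q l.+1 *: (A l.+1 (q - l)%N *+ l.+1))); last first.
  move=> l _; rewrite lift0 cS; last by rewrite -ltnS.
  by rewrite subSS scalerBl; congr (_ - _); rewrite -scalerMnl scalerMnr.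
rewrite sumrB; congr (_ - _).
rewrite big_ord_recl mulr0n scaler0 add0r [RHS]big_ord_recr /=.
rewrite cq scale0r addr0.
by apply: eq_bigr => l _; rewrite /bump /= add1n subnSK.
Qed.

End NormalOrdering.

(** * Derivatives of the coefficients of the characteristic polynomial *)

Section PairDelta.
Variables (K : comNzRingType) (T : eqType).

Definition pair_delta (s : seq (T * T)) : K := kdelta K (unzip1 s) (unzip2 s).

(** Exchanging two adjacent pairs changes the sign once for the rows and once for the columns;
    exchanging only their row entries changes it once. *)
Lemma pair_alternating_delta : pair_alternating pair_delta.
Proof.
have swap1 (s1 s2 t : seq T) a b :
    kdelta K (s1 ++ a :: b :: s2) t = - kdelta K (s1 ++ b :: a :: s2) t.
  exact: (@kdelta_swapl K T _ t s1 a [::] b s2 erefl).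
have swap2 (s1 s2 t : seq T) a b : size (s1 ++ a :: b :: s2) = size t ->
    kdelta K t (s1 ++ a :: b :: s2) = - kdelta K t (s1 ++ b :: a :: s2).
  by move=> st; exact: (@kdelta_swapr K T t s1 a [::] b s2 st).
split=> [|a b c d s]; last exact: (swap1 [::]).
apply: perm_eq_swap_invariant => s1 [a a'] [b b'] s2.
rewrite /pair_delta /unzip1 /unzip2 !map_cat /= swap1 swap2 ?opprK //.
by rewrite !size_cat /= !size_map.
Qed.

End PairDelta.

Section Minors.
Variables (K : numFieldType) (R : comAlgType K) (m k : nat).
Variables (ord : ksubset m k -> k.-tuple 'I_m).
Hypothesis ordP : forall A, [set i in ord A] = val A.

(** For fixed [a] the sum over [b] gives minors with rows [a], by way of the transpose. Both these
    and [F] alternate in [a], so the remaining sum is symmetric and produces the single factor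
    [k!]. *)
Lemma sum_pair_minors (M : 'M[R]_m) (F : k.-tuple 'I_m -> k.-tuple 'I_m -> K) :
  (forall b, alternating (fun a => F a b : K^o)) ->
  (forall a, alternating (fun b => F a b : K^o)) ->
  \sum_a \sum_b F a b *: \prod_t M (tnth a t) (tnth b t)
  = (\sum_A \sum_B F (ord A) (ord B) *: \det (submx_tuple M (ord A) (ord B))) *+ k`!.
Proof.
move=> altl altr.
have commM i a j b : M i a * M j b = M j b * M i a by rewrite mulrC.
transitivity (\sum_a \sum_B F a (ord B) *: \det (submx_tuple M a (ord B))).
  apply: eq_bigr => a _.
  have -> : \sum_b F a b *: \prod_t M (tnth a t) (tnth b t)
      = \sum_b F a b *: \prod_t M^T (tnth b t) (tnth a t).
    by apply: eq_bigr => b _; congr (_ *: _); apply: eq_bigr => t _; rewrite mxE.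
  rewrite (sum_alternating_prod (M := M^T) _ ordP a (altr a)); last first.
    by move=> *; rewrite !mxE mulrC.
  apply: eq_bigr => B _; rewrite -det_tr; congr (_ *: \det _).
  by apply/matrixP => i j; rewrite !mxE.
apply: (big_symmetric_tuple ordP) => [a na|s a].
  by rewrite big1 // => B _; rewrite (alternating_notuniq (altl (ord B)) na) scale0r.
apply: eq_bigr => B _; rewrite (det_submx_tuple_altl commM) scalerA.
have -> : F (perm_act s a) (ord B) = (-1) ^+ s * F a (ord B) by apply: altl.
by rewrite mulrAC -signr_addb addbb mul1r.
Qed.

End Minors.

Lemma eq_mxvec_index n r (i j : 'I_n) (a b : 'I_r) :
  (mxvec_index i a == mxvec_index j b) = (i == j) && (a == b).
Proof.
apply/eqP/andP => [e|[/eqP-> /eqP->] //].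
(* A vectorized matrix unit is 1 at its own index only, and so separates distinct index pairs. *)
have := congr1 (fun k => (mxvec (delta_mx i a : 'M[int]_(n, r))) 0 k) e.
rewrite !mxvecE !mxE !eqxx [j == i]eq_sym [b == a]eq_sym.
by case: (i == j); case: (a == b).
Qed.

Lemma mderivXU n (R : nzRingType) (i j : 'I_n) :
  ('X_i : {mpoly R[n]})^`M(j) = (i == j)%:R.
Proof.
rewrite mderivX mnm1E; case: eqP => [->|_]; last by rewrite scale0r.
rewrite (_ : (_ - _)%MM = 0%MM) ?mpolyX0 ?scale1r //.
by apply/mnmP => k; rewrite mnmBE subnn mnm0E.
Qed.

Section Polynomials.
Variables (K : numFieldType) (n : nat).
Local Notation P := {mpoly K[n * n]}.
Local Notation T := 'I_n.

Definition pair_var (e : T * T) : 'I_(n * n) := mxvec_index e.1 e.2.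

(* The polynomial [\sum_w pair_delta (w ++ s) * \prod_(e <- w) y_e], with [w]
   ranging over the [k]-tuples of pairs, in a form suited to differentiation. *)
Fixpoint minor_poly (s : seq (T * T)) (k : nat) : P :=
  if k is k'.+1 then \sum_e 'X_(pair_var e) * minor_poly (e :: s) k'
  else (pair_delta K s)%:MP.

Lemma minor_poly_perm s t k : perm_eq s t -> minor_poly s k = minor_poly t k.
Proof.
elim: k s t => [|k IHk] s t est /=.
  by rewrite (pair_alternating_perm (pair_alternating_delta K _) est).
by apply: eq_bigr => e _; rewrite (IHk _ (e :: t)) // perm_cons.
Qed.

Lemma pair_var_inj : injective pair_var.
Proof.
by move=> [a b] [c d] /eqP; rewrite eq_mxvec_index /= => /andP[/eqP-> /eqP->].
Qed.

(** Each of the [k.+1] variables contributes the same, by symmetry: the pair [u] leaves the monomial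
    but stays in the delta. *)
Lemma mderiv_minor_poly u s k :
  (minor_poly s k.+1)^`M(pair_var u) = minor_poly (u :: s) k *+ k.+1.
Proof.
have derivX e : ('X_(pair_var e) : P)^`M(pair_var u) = (e == u)%:R.
  by rewrite mderivXU (inj_eq pair_var_inj).
elim: k s => [|k IHk] s.
  rewrite /= linear_sum /= (bigD1 u) //= big1 => [|e /negPf ne].
    by rewrite mderivM derivX eqxx mul1r mderivC mulr0 !addr0.
  by rewrite mderivM derivX ne mul0r mderivC mulr0 addr0.
rewrite [minor_poly s _]/= linear_sum /=.
under eq_bigr do rewrite mderivM derivX -/(minor_poly _ k.+1) IHk.
rewrite big_split /= mulrS; congr (_ + _).
  rewrite (bigD1 u) //= eqxx mul1r [X in _ + X]big1 ?addr0 // => e /negPf ->.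
  by rewrite mul0r.
rewrite -sumrMnl; apply: eq_bigr => e _; rewrite mulrnAr; congr (_ * _ *+ _).
by apply: minor_poly_perm; apply: (permEl (perm_catCA [:: u] [:: e] s)).
Qed.

Definition mderiv_pairs (u : seq (T * T)) (f : P) : P :=
  foldl (fun g e => g^`M(pair_var e)) f u.

Lemma mderiv_pairsMn u f k : mderiv_pairs u (f *+ k) = mderiv_pairs u f *+ k.
Proof. by elim: u f => //= e u IHu f; rewrite mderivMn IHu. Qed.

(** The derivatives bring out the quotient [(size u + k)! / k!], stated without denominators. *)
Lemma mderiv_pairs_minor_poly u s k :
  mderiv_pairs u (minor_poly s (size u + k)) *+ k`!
  = minor_poly (u ++ s) k *+ (size u + k)`!.
Proof.
elim: u s => //= e u IHu s.
rewrite [mderiv_pairs _ _]/= -/(mderiv_pairs u _) addSn mderiv_minor_poly.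
rewrite mderiv_pairsMn mulrnAC IHu factS mulnC mulrnA; congr (_ *+ _ *+ _).
by apply: minor_poly_perm; apply: (permEl (perm_catCA u [:: e] s)).
Qed.

Lemma minor_polyE s k : minor_poly s k =
  \sum_(w : k.-tuple (T * T)) pair_delta K (w ++ s) *: \prod_(e <- w) Ymx K n e.1 e.2.
Proof.
elim: k s => [|k IHk] s.
  by rewrite big_tuple0 big_nil -mul_mpolyC mulr1.
rewrite big_tupleS /=; apply: eq_bigr => e _; rewrite IHk mulr_sumr.
apply: eq_bigr => w _; rewrite big_cons mxE -scalerAr; congr (_ *: _).
apply: (pair_alternating_perm (pair_alternating_delta K _)).
exact: (permEl (perm_catCA w [:: e] s)).
Qed.

End Polynomials.

Lemma prod_zip_tuple (R : pzSemiRingType) (T1 T2 : Type) k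
    (a : k.-tuple T1) (b : k.-tuple T2) (F : T1 * T2 -> R) :
  \prod_(e <- zip a b) F e = \prod_(t < k) F (tnth a t, tnth b t).
Proof.
rewrite (big_tuple _ _ [tuple of zip a b]); apply: eq_bigr => t _.
congr F; case: k a b t => [|k] a b t; first by case: t.
rewrite !(tnth_nth (thead a, thead b)) /= nth_zip ?size_tuple //.
by rewrite (tnth_nth (thead a)) (tnth_nth (thead b)).
Qed.

Section PrincipalMinors.
Variables (K : numFieldType) (n : nat).

(** [sum_pair_minors] gives [k!] times a double sum of minors over subsets, which the reproducing
    property of the delta reduces to the principal minors. *)
Lemma cminor_minor_poly k :
  cminor K n k *+ k`! = minor_poly K [::] k.
Proof.
have enumP (A : ksubset n k) : size (enum (val A)) == k.
  by rewrite -cardE (valP A).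
pose ord A := Tuple (enumP A).
have ordP A : [set i in ord A] = val A.
  by apply/setP => i; rewrite inE mem_enum.
rewrite minor_polyE.
transitivity (\sum_(a : k.-tuple 'I_n) \sum_(b : k.-tuple 'I_n)
    kdelta K a b *: \prod_t Ymx K n (tnth a t) (tnth b t)).
  rewrite (sum_pair_minors ordP (Ymx K n) (F := fun a b => kdelta K a b)); first last.
  - exact: kdelta_altr.
  - exact: kdelta_altl.
  congr (_ *+ _); rewrite exchange_big /=.
  have altY B := det_submx_tuple_altl (R := {mpoly K[n * n]})
    (fun i a j b => mulrC (Ymx K n i a) (Ymx K n j b)) (ord B).
  rewrite /cminor (reindex_omap (val : ksubset n k -> _) insub) /=; last first.
    by move=> A cA; rewrite insubT.
  apply: eq_big => [B|B _]; first by rewrite valK eqxx (valP B).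
  rewrite (sum_kdelta_alternating (altY B) ordP (ord B)).
  (* [enum_val] is indexed by [#|C|] and the tuple by [j]; keeping [j] general allows the equation
     between them to be eliminated. *)
  have minor_enum j (C : {set 'I_n}) (t : j.-tuple 'I_n) : tval t = enum C ->
      \det (mxsub (@enum_val _ C) (@enum_val _ C) (Ymx K n))
      = \det (submx_tuple (Ymx K n) t t).
    move=> et; have jC : #|C| = j by rewrite cardE -et size_tuple.
    case: j / jC t et => t et; congr (\det _); apply/matrixP => a b; rewrite !mxE.
    by rewrite /enum_val (tnth_nth (enum_default a)) (tnth_nth (enum_default b)) et.
  exact: minor_enum.
rewrite (big_tuple_pair _ (fun w => pair_delta K (w ++ [::])
  *: \prod_(e <- w) Ymx K n e.1 e.2)).
apply: eq_bigr => a _; apply: eq_bigr => b _.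
by rewrite cats0 prod_zip_tuple /pair_delta unzip1_zip ?unzip2_zip ?size_tuple.
Qed.

End PrincipalMinors.

(** * Iterating the operator on scalar polynomials *)

Section KirillovWei.
Variables (K : numFieldType) (n r : nat).
Local Notation A := (endo (pol K n r)).
Local Notation P := {mpoly K[n * n]}.

Definition pair_op (e : 'I_n * 'I_n) : A := Lop K r e.2 e.1.

(** The elementary tensor of a scalar polynomial and a constant operator; [kirillov_wei] sends it to
    a sum of such tensors. *)
Definition scalar_map (f : P) (c : A) : polmap K n r :=
  map_mpoly (in_alg A) f * c%:MP.

Lemma mderiv_map_mpoly (f : P) i :
  (map_mpoly (in_alg A) f)^`M(i) = map_mpoly (in_alg A) f^`M(i).
Proof.
by apply/mpolyP => m; rewrite mcoeff_map_mpoly !mcoeff_deriv mcoeff_map_mpoly raddfMn.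
Qed.

Lemma kirillov_wei_scalar_map f c :
  kirillov_wei (scalar_map f c)
  = \sum_e scalar_map f^`M(pair_var e) (c * pair_op e).
Proof.
rewrite /kirillov_wei exchange_big pair_big /=; apply: eq_bigr => -[j i] _ /=.
rewrite /scalar_map mderivM mderivC [X in (_ + X) * _]mulr0 addr0 mderiv_map_mpoly.
by rewrite mpolyCM mulrA.
Qed.

(** Each application appends one derivative and multiplies by its operator on the right, so the
    product follows the order of [u]. *)
Lemma iter_kirillov_wei f q :
  iter q (@kirillov_wei K n r) (map_mpoly (in_alg A) f)
  = \sum_(u : q.-tuple ('I_n * 'I_n)) scalar_map (mderiv_pairs u f) (\prod_(e <- u) pair_op e).
Proof.
elim: q => [|q IHq].
  by rewrite big_tuple0 /= big_nil /scalar_map mulr1.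
rewrite iterS IHq.
rewrite (big_tuple_rcons _ (fun u => scalar_map (mderiv_pairs u f)
  (\prod_(e <- u) pair_op e))).
have -> : kirillov_wei (\sum_(u : q.-tuple ('I_n * 'I_n))
    scalar_map (mderiv_pairs u f) (\prod_(e <- u) pair_op e))
  = \sum_(u : q.-tuple ('I_n * 'I_n)) kirillov_wei
    (scalar_map (mderiv_pairs u f) (\prod_(e <- u) pair_op e)).
  rewrite /kirillov_wei [RHS]exchange_big; apply: eq_bigr => i _ /=.
  rewrite [RHS]exchange_big; apply: eq_bigr => j _ /=.
  by rewrite linear_sum mulr_suml.
under eq_bigr do rewrite kirillov_wei_scalar_map.
rewrite exchange_big; apply: eq_bigr => e _; apply: eq_bigr => u _ /=.
by rewrite big_rcons /mderiv_pairs foldl_rcons.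
Qed.

(** By additivity [f] is expanded into monomials, which commute with the constant [c] although the
    coefficients do not commute among themselves. *)
Lemma polmap_eval_scalar_map (Y : 'M[K]_n) f c :
  polmap_eval (scalar_map f c) Y = f.@[fun k => mxvec Y 0 k] *: c.
Proof.
rewrite /polmap_eval /scalar_map [f in LHS]mpolyE raddf_sum mulr_suml raddf_sum /=.
rewrite mevalE scaler_suml; apply: eq_bigr => m _.
rewrite map_mpolyZ map_mpolyX /= -scalerAl -commr_mpolyX mul_mpolyC !mmapZ mmapX /=.
rewrite /mmap1 -scalerA -[_%:A * _]scalerAl mul1r; congr (_ *: _).
rewrite (_ : \prod_i _ = (\prod_i mxvec Y 0 i ^+ m i)%:A).
  by rewrite -scalerAr mulr1.
by rewrite -[RHS]/(in_alg A _) rmorph_prod; apply: eq_bigr => i _; rewrite rmorphXn.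
Qed.

End KirillovWei.

(** * The signs [sgnt] and [epst] as Kronecker deltas *)

Section Signs.
Variables (K : numFieldType) (n : nat).

Lemma kdelta_notuniq k (I J : k.-tuple 'I_n) : ~~ uniq J -> kdelta K I J = 0.
Proof.
by move=> nJ; have := alternating_notuniq (V := K^o) (@kdelta_altr K n k I) nJ.
Qed.

Lemma sgntE k (I J : k.-tuple 'I_n) : uniq J -> (sgnt I J)%:~R = kdelta K I J.
Proof.
move=> uJ; rewrite /sgnt; case: pickP => [t /eqP ->|nt].
  by rewrite kdelta_perml kdeltaxx // mulr1 rmorphXn rmorphN1.
have [->//|/kdelta_neq0[t e]] := eqVneq (kdelta K I J) 0.
by move: (nt t); rewrite e eqxx.
Qed.

Lemma kdelta_cat_neq0 j k (I : (j + k).-tuple 'I_n) (J : j.-tuple 'I_n) (v : k.-tuple 'I_n) :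
  kdelta K I (J ++ v) != 0 -> exists s, perm_act s I = [tuple of J ++ v].
Proof.
move/(@kdelta_neq0 K _ _ I [tuple of J ++ v]) => [s ->].
by exists s^-1%g; rewrite perm_actK.
Qed.

(** With [v0] the common tail, the two deltas are the signs of [s] and [t] times [kdelta K v v0],
    whose squares sum to [k!]. *)
Lemma sum_kdelta_common j k (I1 J1 : (j + k).-tuple 'I_n) (I2 J2 : j.-tuple 'I_n) s t :
  uniq I1 -> uniq J1 ->
  take j (perm_act s I1) == I2 :> seq _ -> take j (perm_act t J1) == J2 :> seq _ ->
  drop j (perm_act s I1) == drop j (perm_act t J1) ->
  \sum_(v : k.-tuple 'I_n) kdelta K I1 (I2 ++ v) * kdelta K J1 (J2 ++ v)
  = (-1) ^+ (s * t)%g *+ k`!.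
Proof.
move=> uI uJ /eqP takeI /eqP takeJ /eqP dropIJ.
have dropP : size (drop j (perm_act s I1)) == k by rewrite size_drop size_tuple addKn.
pose v0 := Tuple dropP.
have eI : perm_act s I1 = [tuple of I2 ++ v0].
  by apply: val_inj; rewrite /= -takeI cat_take_drop.
have eJ : perm_act t J1 = [tuple of J2 ++ v0].
  by apply: val_inj; rewrite /= -takeJ dropIJ cat_take_drop.
have uIv : uniq (I2 ++ v0).
  by rewrite -[_ ++ _]/(tval [tuple of I2 ++ v0]) -eI (perm_uniq (perm_eq_perm_act _ _)).
have uJv : uniq (J2 ++ v0).
  by rewrite -[_ ++ _]/(tval [tuple of J2 ++ v0]) -eJ (perm_uniq (perm_eq_perm_act _ _)).
have uv : uniq v0 by move: uIv; rewrite cat_uniq => /and3P[].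
have step (M : (j + k).-tuple 'I_n) (N : j.-tuple 'I_n) u (v : k.-tuple 'I_n) :
    perm_act u M = [tuple of N ++ v0] -> uniq (N ++ v0) ->
    kdelta K M (N ++ v) = (-1) ^+ u * kdelta K v v0.
  move=> eM uN; rewrite -(perm_actK u M) kdelta_perml odd_permV eM.
  by rewrite kdelta_catl ?size_tuple // (kdeltaC _ (s := v0)) ?size_tuple.
under eq_bigr => v _ do
  rewrite (step I1 I2 s v eI uIv) (step J1 J2 t v eJ uJv) mulrACA -signr_addb -odd_permM.
rewrite -mulr_sumr.
have := sum_kdelta_alternating_tuple (V := K^o) (@kdelta_altl K n k v0) v0.
rewrite kdeltaxx // => sum1.
rewrite (_ : \sum_v _ = 1 *+ k`!); last exact: sum1.
by rewrite mulrnAr mulr1.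
Qed.

(** A nonzero summand exhibits permutations that carry [I1] to [I2 ++ v] and [J1] to [J2 ++ v], so
    both tests in [epst] succeed. If one of them fails, both sides vanish; otherwise
    [sum_kdelta_common] applies. *)
Lemma epstE j k (I1 J1 : (j + k).-tuple 'I_n) (I2 J2 : j.-tuple 'I_n) :
  uniq I1 -> uniq J1 ->
  (epst I1 J1 I2 J2)%:~R *+ k`!
  = \sum_(v : k.-tuple 'I_n) kdelta K I1 (I2 ++ v) * kdelta K J1 (J2 ++ v).
Proof.
move=> uI uJ.
have diff (M : (j + k).-tuple 'I_n) (N : j.-tuple 'I_n) (v : k.-tuple 'I_n) u :
    uniq M -> perm_act u M = [tuple of N ++ v] ->
    [set i in M] :\: [set i in N] = [set i in v].
  move=> uM eM; apply/setP => i; rewrite !inE.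
  have -> : (i \in M) = (i \in N ++ v).
    by rewrite -(perm_mem (perm_eq_perm_act u M)) eM.
  have := uM; rewrite -(perm_uniq (perm_eq_perm_act u M)) eM cat_uniq.
  case/and3P => _ /hasPn nN _; rewrite mem_cat.
  by case: (boolP (i \in v)) => [/nN /= /negPf->|_]; rewrite ?orbT ?orbF ?andNb.
have witness (v : k.-tuple 'I_n) : kdelta K I1 (I2 ++ v) * kdelta K J1 (J2 ++ v) != 0 :> K ->
    exists s t, perm_act s I1 = [tuple of I2 ++ v] /\ perm_act t J1 = [tuple of J2 ++ v].
  rewrite mulf_eq0 negb_or => /andP[/kdelta_cat_neq0[s es] /kdelta_cat_neq0[t et]].
  by exists s, t.
rewrite /epst; case: ifP => [cond|/negP ncond].
  case: pickP => [[s t] /= /and3P[ts tt td]|npick].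
    by rewrite (sum_kdelta_common uI uJ ts tt td) rmorphXn rmorphN1.
  rewrite mul0rn big1 // => v _; apply: contraTeq isT => /witness[s [t [es et]]].
  case/negP: (negbT (npick (s, t))); apply/and3P.
  change ([/\ take j (perm_act s I1) == I2 :> seq _, take j (perm_act t J1) == J2 :> seq _
    & drop j (perm_act s I1) == drop j (perm_act t J1)]).
  by rewrite es et /= !take_size_cat ?drop_size_cat ?size_tuple.
rewrite mul0rn big1 // => v _; apply/eqP; apply: contra_notT ncond => /witness[s [t [es et]]].
rewrite (diff _ _ _ _ uI es) (diff _ _ _ _ uJ et) eqxx /= addKn.
have uv : uniq v.
  by move: uI; rewrite -(perm_uniq (perm_eq_perm_act s I1)) es cat_uniq => /and3P[].
by rewrite cardsE (card_uniqP uv) size_tuple.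
Qed.

End Signs.

Section KdeltaCat.
Variables (K : comNzRingType) (n j k : nat).

Lemma kdelta_cat_altl (s1 s2 t : seq 'I_n) :
  alternating (fun I : j.-tuple 'I_n => kdelta K (s1 ++ I ++ s2) t : K^o).
Proof.
apply: (@swap_alternatingP _ K^o _ _ (fun I => kdelta K (s1 ++ I ++ s2) t)).
exact: swap_alternating_cat (@kdelta_swapl K _ _ t) erefl.
Qed.

Lemma kdelta_cat_altr (s1 s2 t : seq 'I_n) : (size s1 + (j + size s2))%N = size t ->
  alternating (fun I : j.-tuple 'I_n => kdelta K t (s1 ++ I ++ s2) : K^o).
Proof.
move=> et; apply: (@swap_alternatingP _ K^o _ _ (fun I => kdelta K t (s1 ++ I ++ s2))).
exact: swap_alternating_cat (@kdelta_swapr K _ t) et.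
Qed.

End KdeltaCat.

(** * Sums over subtuples and products of minors *)

Section SubtupleSums.
Variables (K : numFieldType) (V : lmodType K) (n q l : nat).
Variables (ordn : ksubset n l -> l.-tuple 'I_n) (ordq : ksubset q l -> l.-tuple 'I_q).
Hypothesis ordnP : forall A, [set i in ordn A] = val A.
Hypothesis ordqP : forall A, [set i in ordq A] = val A.

Lemma subtuple_inj (J : q.-tuple 'I_n) : uniq J -> injective (@subtuple n q l J).
Proof.
move=> /tuple_uniqP injJ c d e; apply: eq_from_tnth => t; apply: injJ.
by have := congr1 (fun u => tnth u t) e; rewrite !tnth_mktuple.
Qed.

(** The delta restricts subsets of [[n]] to those contained in [J], which correspond to sets of
    positions in [J]. After multiplication by [l!] the comparison is between tuples. *)
Lemma sum_subtuple (J : q.-tuple 'I_n) (v : seq 'I_n) (F : l.-tuple 'I_n -> V) :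
  uniq J -> (l + size v)%N = q -> alternating F ->
  \sum_W kdelta K J (subtuple J (ordq W) ++ v) *: F (subtuple J (ordq W))
  = \sum_B kdelta K J (ordn B ++ v) *: F (ordn B).
Proof.
move=> uJ elv altF.
pose h (b : l.-tuple 'I_n) : V := kdelta K J (b ++ v) *: F b.
have h_uniq (b : l.-tuple 'I_n) : ~~ uniq b -> h b = 0.
  by move=> nb; rewrite /h (alternating_notuniq altF nb) scaler0.
have h_perm s b : h (perm_act s b) = h b.
  rewrite /h altF scalerA.
  have := @kdelta_cat_altr K n l [::] v J _ s b; rewrite size_tuple => /(_ elv) /= ->.
  by rewrite mulrC mulrA -signr_addb addbb mul1r.
have ln0 : l`!%:R != 0 :> K by rewrite Num.Theory.pnatr_eq0 -lt0n fact_gt0.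
apply: (scalerI ln0); rewrite !scaler_nat.
rewrite -(big_symmetric_tuple ordnP h_uniq h_perm).
rewrite -(big_symmetric_tuple ordqP (F := fun c => h (subtuple J c))); first last.
- move=> s c; rewrite -[RHS](h_perm s); congr h; apply: eq_from_tnth => t.
  by rewrite !tnth_mktuple.
- move=> c nc; apply: h_uniq; apply: contra nc => /tuple_uniqP inj.
  apply/tuple_uniqP => s t e; apply: inj; rewrite !tnth_mktuple.
  by rewrite e.
(* Outside the image of [subtuple J] the terms vanish: a nonzero delta puts every entry of [b] in
   [J], and choosing a position for each writes [b] as a subtuple. *)
rewrite [RHS](bigID (mem [set subtuple J c | c in [set: l.-tuple 'I_q]])) /=.
rewrite big_imset /=; last by move=> c d _ _; apply: subtuple_inj.
rewrite [X in _ + X]big1 ?addr0 => [|b]; first by apply: eq_bigl => c; rewrite inE.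
apply: contraNeq => hb; have : kdelta K J (b ++ v) != 0.
  by apply: contraNneq hb; rewrite /h => ->; rewrite scale0r.
have bvP : size (b ++ v) == q by rewrite size_cat size_tuple elv.
move/(@kdelta_neq0 K _ _ J (Tuple bvP)) => [s eJ].
have mem_b t : exists i, tnth b t == tnth J i.
  have /tnthP[i ->] : tnth b t \in J; last by exists i.
  by rewrite eJ (perm_mem (perm_eq_perm_act _ _)) mem_cat mem_tnth.
apply/imsetP; exists [tuple xchoose (mem_b t) | t < l]; first by rewrite inE.
by apply: eq_from_tnth => t; rewrite !tnth_mktuple; apply/eqP/(xchooseP (mem_b t)).
Qed.

End SubtupleSums.

Section NormalProducts.
Variables (K : numFieldType) (R : algType K) (n r : nat) (X D : 'M[R]_(n, r)).
Hypothesis commX : forall i a j b, X i a * X j b = X j b * X i a.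
Hypothesis commD : forall i a j b, D i a * D j b = D j b * D i a.
Variable ord : forall m k, ksubset m k -> k.-tuple 'I_m.
Hypothesis ordP : is_ordering ord.

(** [commD] brings the reversed [D] factors into the order of [a]. *)
Lemma normal_product_zip l (a b : l.-tuple 'I_n) :
  normal_product X D (zip a b) =
  \sum_(c : l.-tuple 'I_r) \prod_t X (tnth b t) (tnth c t) * \prod_t D (tnth a t) (tnth c t).
Proof.
under eq_bigr do rewrite -(prod_zip_tuple _ _ (fun e => X e.1 e.2))
  -(prod_zip_tuple _ _ (fun e => D e.1 e.2)).
elim: l a b => [|l IHl] a b.
  by rewrite (tuple0 a) (tuple0 b) big_tuple0 /= !big_nil mulr1.
case/tupleP: a => i a; case/tupleP: b => j b; rewrite big_tupleS /=.
apply: eq_bigr => c _; rewrite IHl mulr_sumr mulr_suml; apply: eq_bigr => u _.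
rewrite !big_cons -!mulrA; congr (_ * (_ * _)).
by apply: commr_sym; apply: commr_prod => e _; apply: commD.
Qed.

(** A normally ordered operator of Capelli type; [b] indexes rows of [X] and [a] rows of [D]. *)
Definition minor_product l (b a : l.-tuple 'I_n) : R :=
  \sum_(T : ksubset r l) \det (submx_tuple X b (ord T)) * \det (submx_tuple D a (ord T)).

Lemma minor_product_altl l (a : l.-tuple 'I_n) : alternating (fun b => minor_product b a).
Proof.
move=> s b; rewrite /minor_product scaler_sumr; apply: eq_bigr => T _.
by rewrite (det_submx_tuple_altl commX) scalerAl.
Qed.

Lemma minor_product_altr l (b : l.-tuple 'I_n) : alternating (minor_product b).
Proof.
move=> s a; rewrite /minor_product scaler_sumr; apply: eq_bigr => T _.
by rewrite (det_submx_tuple_altl commD) scalerAr.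
Qed.

(** For fixed columns [c] the sums over [a] and [b] give minors of [D] and [X]. Both minors
    alternate in [c], so their product is symmetric and the sum over [c] yields [l!]. *)
Lemma sum_normal_product_alternating l (F : l.-tuple 'I_n -> l.-tuple 'I_n -> K) :
  (forall b, alternating (fun a => F a b : K^o)) ->
  (forall a, alternating (fun b => F a b : K^o)) ->
  \sum_a \sum_b F a b *: normal_product X D (zip a b)
  = (\sum_A \sum_B F (ord A) (ord B) *: minor_product (ord B) (ord A)) *+ l`!.
Proof.
move=> altl altr.
transitivity (\sum_(c : l.-tuple 'I_r) \sum_A \sum_B F (ord A) (ord B) *:
    (\det (submx_tuple X (ord B) c) * \det (submx_tuple D (ord A) c))).
  under eq_bigr => a _ do under eq_bigr => b _ do rewrite normal_product_zip scaler_sumr.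
  under eq_bigr do rewrite exchange_big.
  rewrite exchange_big; apply: eq_bigr => c _ /=.
  transitivity (\sum_a \sum_B F a (ord B) *: (\det (submx_tuple X (ord B) c)
      * \prod_t D (tnth a t) (tnth c t))).
    apply: eq_bigr => a _.
    under eq_bigr do rewrite scalerAl.
    rewrite -mulr_suml (sum_alternating_prod commX (@ordP _ _) c (altr a)) mulr_suml.
    by apply: eq_bigr => B _; rewrite scalerAl.
  rewrite exchange_big [RHS]exchange_big; apply: eq_bigr => B _ /=.
  under eq_bigr do rewrite scalerAr.
  rewrite -mulr_sumr (sum_alternating_prod commD (@ordP _ _) c (altl (ord B))) mulr_sumr.
  by apply: eq_bigr => A _; rewrite scalerAr.
rewrite exchange_big -sumrMnl; apply: eq_bigr => A _ /=.
rewrite exchange_big -sumrMnl; apply: eq_bigr => B _ /=.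
rewrite -scaler_sumr scalerMnr; congr (_ *: _).
apply: (big_symmetric_tuple (@ordP _ _)) => [c nc|s c].
  by rewrite (alternating_notuniq (det_submx_tuple_altr X (ord B)) nc) mul0r.
rewrite !det_submx_tuple_altr -scalerAl -scalerAr scalerA.
by rewrite -signr_addb addbb scale1r.
Qed.

Lemma sum_epst p l k (I1 J1 : p.-tuple 'I_n) :
  (\sum_(I2 : ksubset n (l + k)) \sum_(J2 : ksubset n (l + k))
    kdelta K (I1 ++ ord I2) (J1 ++ ord J2) *:
    \sum_(T : ksubset r l) \sum_(V : ksubset (l + k) l) \sum_(W : ksubset (l + k) l)
      (epst (ord J2) (ord I2) (subtuple (ord J2) (ord V)) (subtuple (ord I2) (ord W)))%:~R *:
      (\det (submx_tuple X (subtuple (ord J2) (ord V)) (ord T)) *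
       \det (submx_tuple D (subtuple (ord I2) (ord W)) (ord T)))) *+ k`!
  = \sum_(v : k.-tuple 'I_n) \sum_A \sum_B
      kdelta K (I1 ++ ord A ++ v) (J1 ++ ord B ++ v) *:
      minor_product (ord B : l.-tuple 'I_n) (ord A).
Proof.
(* [epstE] absorbs [k!] and introduces the common tail [v]; [sum_subtuple] then turns the position
   sets [V] and [W] into subsets [B] and [A] of [[n]]. *)
transitivity (\sum_(v : k.-tuple 'I_n) \sum_(A : ksubset n l) \sum_(B : ksubset n l)
  \sum_(I2 : ksubset n (l + k)) \sum_(J2 : ksubset n (l + k))
    (kdelta K (I1 ++ ord I2) (J1 ++ ord J2) * (kdelta K (ord J2) (ord B ++ v)
     * kdelta K (ord I2) (ord A ++ v))) *: minor_product (ord B) (ord A)).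
  under [RHS]eq_bigr do under eq_bigr do rewrite exchange_big.
  under [RHS]eq_bigr do rewrite exchange_big.
  rewrite [RHS]exchange_big -sumrMnl; apply: eq_bigr => I2 _ /=.
  under [RHS]eq_bigr do under eq_bigr do rewrite exchange_big.
  under [RHS]eq_bigr do rewrite exchange_big.
  rewrite [RHS]exchange_big -sumrMnl; apply: eq_bigr => J2 _ /=.
  have uI2 : uniq (ord I2) by apply: ord_uniq; apply: ordP.
  have uJ2 : uniq (ord J2) by apply: ord_uniq; apply: ordP.
  under [RHS]eq_bigr do under eq_bigr do under eq_bigr do rewrite -scalerA.
  under [RHS]eq_bigr do under eq_bigr do rewrite -scaler_sumr.
  under [RHS]eq_bigr do rewrite -scaler_sumr.
  rewrite -scaler_sumr scalerMnr; congr (_ *: _).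
  rewrite exchange_big -sumrMnl /=.
  under eq_bigr do rewrite exchange_big -sumrMnl /=.
  under eq_bigr do under eq_bigr do rewrite -scaler_sumr scalerMnl epstE // scaler_suml.
  under eq_bigr do rewrite exchange_big /=.
  rewrite exchange_big; apply: eq_bigr => v _ /=.
  rewrite [RHS]exchange_big /=.
  under eq_bigr do under eq_bigr do rewrite -scalerA.
  under eq_bigr do rewrite -scaler_sumr.
  have size_v : (l + size v)%N = (l + k)%N by rewrite size_tuple.
  under eq_bigr => V _ do
    rewrite (sum_subtuple (@ordP _ _) (@ordP _ _) uI2 size_v (minor_product_altr _)).
  rewrite (sum_subtuple (@ordP _ _) (@ordP _ _) uJ2 size_v
    (F := fun b => \sum_A kdelta K (ord I2) (ord A ++ v) *: minor_product b (ord A))).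
    apply: eq_bigr => B _; rewrite scaler_sumr; apply: eq_bigr => A _.
    by rewrite scalerA.
  move=> s b; rewrite scaler_sumr; apply: eq_bigr => A _.
  by rewrite minor_product_altl !scalerA mulrC.
apply: eq_bigr => v _; apply: eq_bigr => A _; apply: eq_bigr => B _.
under eq_bigr do rewrite -scaler_suml.
rewrite -scaler_suml; congr (_ *: _).
(* The sums over [J2] and [I2] are reproducing sums: they put [ord B ++ v] and [ord A ++ v] into the
   remaining delta. *)
have altr (I2 : (l + k).-tuple 'I_n) :
    alternating (fun J : (l + k).-tuple 'I_n => kdelta K (I1 ++ I2) (J1 ++ J) : K^o).
  move=> s J; have := @kdelta_cat_altr K n (l + k) J1 [::] (I1 ++ I2) _ s J.
  by rewrite !cats0; apply; rewrite size_cat !size_tuple addn0.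
have altl (J2 : seq 'I_n) :
    alternating (fun I : (l + k).-tuple 'I_n => kdelta K (I1 ++ I) (J1 ++ J2) : K^o).
  move=> s I; have := @kdelta_cat_altl K n (l + k) I1 [::] (J1 ++ J2) s I.
  by rewrite !cats0.
pose Av := [tuple of ord A ++ v]; pose Bv := [tuple of ord B ++ v].
transitivity (\sum_(I2 : ksubset n (l + k))
    kdelta K (ord I2) Av * kdelta K (I1 ++ ord I2) (J1 ++ Bv)).
  apply: eq_bigr => I2 _.
  rewrite -(sum_kdelta_alternating (altr (ord I2)) (@ordP _ _) Bv) mulr_sumr.
  by apply: eq_bigr => J2 _; rewrite mulrC [X in X * _]mulrC -mulrA.
exact: (sum_kdelta_alternating (altl Bv) (@ordP _ _) Av).
Qed.

End NormalProducts.

(** * The Kirillov-Wei operators *)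

Section WeylRelations.
Variables (K : comNzRingType) (n r : nat).
Local Notation X := (Xmx K n r).
Local Notation D := (Dmx K n r).

Lemma Xmx_comm i a j b : X i a * X j b = X j b * X i a.
Proof. by rewrite !mxE; apply: endoP => f; apply: mulrCA. Qed.

Lemma Dmx_comm i a j b : D i a * D j b = D j b * D i a.
Proof. by rewrite !mxE; apply: endoP => f; apply: mderiv_comm. Qed.

Lemma Dmx_Xmx_comm i a j b :
  D i a * X j b = X j b * D i a + ((i == j) && (a == b))%:R.
Proof.
rewrite -eq_mxvec_index !mxE; apply: endoP => f.
change ((('X_(mxvec_index j b) * f)^`M(mxvec_index i a))
  = 'X_(mxvec_index j b) * f^`M(mxvec_index i a)
    + endo_fun ((mxvec_index i a == mxvec_index j b)%:R : endo (pol K n r)) f).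
rewrite mderivM addrC mderivXU eq_sym; congr (_ + _).
by case: eqP => _; [rewrite mul1r | rewrite mul0r].
Qed.

End WeylRelations.

Lemma pair_alternating_catl (T : eqType) (V : zmodType) (Phi : seq (T * T) -> V) w :
  pair_alternating Phi -> pair_alternating (fun s => Phi (w ++ s)).
Proof.
case=> permPhi swapPhi; split=> [s t est|a b c d s].
  by apply: permPhi; rewrite perm_cat2l.
have catC s' : Phi (w ++ s') = Phi (s' ++ w) by apply: permPhi; rewrite perm_catC.
by rewrite !catC; apply: swapPhi.
Qed.

(** * Evaluation at [Y] and assembly of the formula *)

Section Main.
Variables (K : numFieldType) (n r p : nat).
Variable ord : forall m k, ksubset m k -> k.-tuple 'I_m.
Hypothesis ordP : is_ordering ord.
Variable Y : 'M[K]_n.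

(** For [u] of size [q], this is the value at [Y] of the derivative of [cminor K n (p + q)] along
    [u], as [meval_mderiv_cminor] shows. *)
Definition minor_coef (u : seq ('I_n * 'I_n)) : K :=
  \sum_(A : ksubset n p) \sum_(B : ksubset n p)
    \det (submx_tuple Y (ord A) (ord B)) * pair_delta K (zip (ord A) (ord B) ++ u).

Lemma pair_alternating_minor_coef : pair_alternating minor_coef.
Proof.
have alt w := pair_alternating_catl w (pair_alternating_delta K 'I_n).
split=> [s t est|a b c d s].
  apply: eq_bigr => A _; apply: eq_bigr => B _; congr (_ * _).
  exact: (pair_alternating_perm (alt _)).
rewrite /minor_coef -sumrN; apply: eq_bigr => A _; rewrite -sumrN; apply: eq_bigr => B _.
by rewrite (pair_alternating_swap (alt _)) mulrN.
Qed.

Lemma pair_delta_zip_cat k (a b : k.-tuple 'I_n) u :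
  pair_delta K (zip a b ++ u) = kdelta K (a ++ unzip1 u) (b ++ unzip2 u).
Proof.
by rewrite /pair_delta /unzip1 /unzip2 !map_cat -/unzip1 -/unzip2
   unzip1_zip ?unzip2_zip ?size_tuple.
Qed.

Lemma meval_minor_poly u :
  (minor_poly K u p).@[fun k => mxvec Y 0 k] = minor_coef u *+ p`!.
Proof.
rewrite minor_polyE raddf_sum /=.
pose F (a b : p.-tuple 'I_n) : K := kdelta K (a ++ unzip1 u) (b ++ unzip2 u).
(* [K^o] makes [K] an algebra over itself, as [sum_pair_minors] requires. *)
transitivity (\sum_a \sum_b F a b *: \prod_t (Y : 'M[K^o]_n) (tnth a t) (tnth b t)).
  rewrite (big_tuple_pair _ (fun w =>
    (pair_delta K (w ++ u) *: \prod_(e <- w) Ymx K n e.1 e.2).@[fun k => mxvec Y 0 k])).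
  apply: eq_bigr => a _; apply: eq_bigr => b _.
  rewrite mevalZ rmorph_prod /= pair_delta_zip_cat; congr (_ * _).
  rewrite prod_zip_tuple; apply: eq_bigr => t _.
  by rewrite mxE mevalXU mxvecE.
rewrite (sum_pair_minors (@ordP _ _) _ (F := F)).
- congr (_ *+ _); apply: eq_bigr => A _; apply: eq_bigr => B _.
  by rewrite pair_delta_zip_cat mulrC.
- by move=> b; apply: (@kdelta_cat_altl K n p [::]).
- by move=> a; apply: (@kdelta_cat_altr K n p [::]); rewrite size_cat !size_tuple !size_map.
Qed.

(** The factorials [p!] and [(p + q)!] are restored on both sides and cancelled in characteristic
    zero. *)
Lemma meval_mderiv_cminor q (u : q.-tuple ('I_n * 'I_n)) :
  (mderiv_pairs u (cminor K n (p + q))).@[fun k => mxvec Y 0 k] = minor_coef u.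
Proof.
apply: (Num.Theory.pmulrnI (fact_gt0 p)); rewrite -meval_minor_poly.
apply: (Num.Theory.pmulrnI (fact_gt0 (p + q))).
rewrite mulrnAC -!mevalMn -mderiv_pairsMn cminor_minor_poly addnC.
by have := mderiv_pairs_minor_poly K u [::] p; rewrite size_tuple cats0 => <-.
Qed.

Lemma polmap_eval_Mop q :
  polmap_eval (Mop K n r p q) Y
  = \sum_(l < q.+1) ((-1) ^+ (q - l) * (stirling_rec q l)%:R) *:
    \sum_(u : l.-tuple ('I_n * 'I_n)) \sum_(v : (q - l).-tuple 'I_n)
      minor_coef (u ++ diag_pairs v) *: normal_product (Xmx K n r) (Dmx K n r) u.
Proof.
rewrite /Mop iter_kirillov_wei /polmap_eval raddf_sum /=.
rewrite -(normal_ordering (@Dmx_comm K n r) (@Dmx_Xmx_comm K n r) q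
  pair_alternating_minor_coef).
apply: eq_bigr => u _.
by rewrite [LHS]polmap_eval_scalar_map meval_mderiv_cminor.
Qed.

(** The diagonal pairs add the same tail [v] to the rows and the columns of the delta, which
    alternates in each of the remaining blocks [a] and [b]. *)
Lemma sum_normal_minor_coef l k :
  \sum_(u : l.-tuple ('I_n * 'I_n)) \sum_(v : k.-tuple 'I_n)
    minor_coef (u ++ diag_pairs v) *: normal_product (Xmx K n r) (Dmx K n r) u
  = (\sum_(I1 : ksubset n p) \sum_(J1 : ksubset n p)
      \det (submx_tuple Y (ord I1) (ord J1)) *:
      \sum_(v : k.-tuple 'I_n) \sum_A \sum_B
        kdelta K (ord I1 ++ ord A ++ v) (ord J1 ++ ord B ++ v) *:
        minor_product (Xmx K n r) (Dmx K n r) ord (ord B : l.-tuple 'I_n) (ord A)) *+ l`!.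
Proof.
under eq_bigr do under eq_bigr do rewrite scaler_suml.
under eq_bigr do rewrite exchange_big.
rewrite exchange_big -sumrMnl; apply: eq_bigr => I1 _ /=.
under eq_bigr do under eq_bigr do rewrite scaler_suml.
under eq_bigr do rewrite exchange_big.
rewrite exchange_big -sumrMnl; apply: eq_bigr => J1 _ /=.
under eq_bigr do under eq_bigr do rewrite -scalerA.
under eq_bigr do rewrite -scaler_sumr.
rewrite -scaler_sumr scalerMnr; congr (_ *: _).
rewrite exchange_big -sumrMnl; apply: eq_bigr => v _ /=.
rewrite (big_tuple_pair _ (fun u => pair_delta K (zip (ord I1) (ord J1) ++ u ++ diag_pairs v)
  *: normal_product (Xmx K n r) (Dmx K n r) u)).
have diag1 : unzip1 (diag_pairs v) = v by rewrite /unzip1 -map_comp map_id.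
have diag2 : unzip2 (diag_pairs v) = v by rewrite /unzip2 -map_comp map_id.
rewrite -(sum_normal_product_alternating (@Xmx_comm K n r) (@Dmx_comm K n r) ordP
  (F := fun a b => kdelta K (ord I1 ++ a ++ v) (ord J1 ++ b ++ v))).
- apply: eq_bigr => a _; apply: eq_bigr => b _; congr (_ *: _).
  rewrite pair_delta_zip_cat.
  have -> : unzip1 (zip a b ++ diag_pairs v) = a ++ v.
    by rewrite [LHS]map_cat [X in _ ++ X]diag1 [X in X ++ _]unzip1_zip ?size_tuple.
  have -> : unzip2 (zip a b ++ diag_pairs v) = b ++ v.
    by rewrite [LHS]map_cat [X in _ ++ X]diag2 [X in X ++ _]unzip2_zip ?size_tuple.
  by [].
- by move=> b; apply: kdelta_cat_altl.
- by move=> a; apply: kdelta_cat_altr; rewrite !size_cat !size_tuple.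
Qed.

(** The delta vanishes wherever the disjointness or union conditions fail, so the sum extends to all
    [J2]; where they hold, [sgnt] equals the delta. *)
Lemma sum_sgnt (V : lmodType K) q (I1 J1 : ksubset n p) (I2 : ksubset n q) (d : K)
    (Z : ksubset n q -> V) :
  \sum_(J2 : ksubset n q |
      [&& [disjoint val I1 & val I2], [disjoint val J1 & val J2]
        & val I1 :|: val I2 == val J1 :|: val J2])
    ((sgnt [tuple of ord I1 ++ ord I2] [tuple of ord J1 ++ ord J2])%:~R * d) *: Z J2
  = d *: \sum_J2 kdelta K (ord I1 ++ ord I2) (ord J1 ++ ord J2) *: Z J2.
Proof.
have uniq_cat (A : ksubset n p) (B : ksubset n q) :
    uniq (ord A ++ ord B) = [disjoint val A & val B].
  rewrite cat_uniq !(ord_uniq (@ordP _ _)) andbT /= -!ordP -setI_eq0.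
  apply/hasPn/eqP => [AB|/setP AB i iB].
    apply/setP => i; rewrite !inE.
    by case: (boolP (i \in ord B)) => [/AB /negPf->|]; rewrite ?andbF.
  by have := AB i; rewrite !inE iB andbT => /= ->.
rewrite big_mkcond scaler_sumr; apply: eq_bigr => J2 _ /=; rewrite scalerA mulrC.
case: ifP => [/and3P[_ dJ _]|/negbT ncond].
  by rewrite sgntE // uniq_cat.
rewrite (_ : kdelta _ _ _ = 0) ?mulr0 ?scale0r //.
apply: contraNeq ncond => nz.
have uJ : uniq (ord J1 ++ ord J2).
  apply: contraNT nz => nu; apply/eqP.
  exact: (@kdelta_notuniq K n _ [tuple of ord I1 ++ ord I2]
    [tuple of ord J1 ++ ord J2] nu).
have [s eI] := @kdelta_neq0 K _ _ [tuple of ord I1 ++ ord I2] [tuple of ord J1 ++ ord J2] nz.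
have pIJ : perm_eq (ord I1 ++ ord I2) (ord J1 ++ ord J2).
  by rewrite -[_ ++ _]/(tval [tuple of ord I1 ++ ord I2]) eI perm_eq_perm_act.
rewrite -!uniq_cat uJ (perm_uniq pIJ) uJ /= -!ordP; apply/eqP/setP => i.
by rewrite !inE -!mem_cat (perm_mem pIJ).
Qed.

(** Writing [q] as [l + k] fits the type in [epstE]. The factor [k!] belongs to [epst], the factor
    [l!] to the passage from tuples of pairs to minors. *)
Lemma sum_minors_epst q l k : q = (l + k)%N ->
  (\sum_(I1 : ksubset n p) \sum_(J1 : ksubset n p)
    \sum_(I2 : ksubset n q) \sum_(J2 : ksubset n q |
      [&& [disjoint val I1 & val I2], [disjoint val J1 & val J2]
        & val I1 :|: val I2 == val J1 :|: val J2])
    ((sgnt [tuple of ord I1 ++ ord I2] [tuple of ord J1 ++ ord J2])%:~R *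
       \det (submx_tuple Y (ord I1) (ord J1))) *:
    \sum_(T : ksubset r l) \sum_(V : ksubset q l) \sum_(W : ksubset q l)
      (epst (ord J2) (ord I2) (subtuple (ord J2) (ord V)) (subtuple (ord I2) (ord W)))%:~R *:
        (\det (submx_tuple (Xmx K n r) (subtuple (ord J2) (ord V)) (ord T)) *
         \det (submx_tuple (Dmx K n r) (subtuple (ord I2) (ord W)) (ord T)))) *+ k`! *+ l`!
  = \sum_(u : l.-tuple ('I_n * 'I_n)) \sum_(v : k.-tuple 'I_n)
    minor_coef (u ++ diag_pairs v) *: normal_product (Xmx K n r) (Dmx K n r) u.
Proof.
move=> ->; rewrite sum_normal_minor_coef; congr (_ *+ _).
rewrite -sumrMnl; apply: eq_bigr => I1 _; rewrite -sumrMnl; apply: eq_bigr => J1 _.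
under eq_bigr do rewrite sum_sgnt.
rewrite -scaler_sumr scalerMnr; congr (_ *: _).
by rewrite (sum_epst (@Xmx_comm K n r) (@Dmx_comm K n r) ordP).
Qed.

(** The two factorials of [sum_minors_epst], with [k = q - l], join the signed Stirling numbers of
    normal ordering. *)
Lemma polmap_eval_Mop_minors q :
  polmap_eval (Mop K n r p q) Y =
  \sum_(l < q.+1)
    ((-1) ^+ (q - l) * (q - l)`!%:R * l`!%:R * (stirling2 q l)%:R) *:
    \sum_(I1 : ksubset n p) \sum_(J1 : ksubset n p)
    \sum_(I2 : ksubset n q) \sum_(J2 : ksubset n q |
        [&& [disjoint val I1 & val I2], [disjoint val J1 & val J2]
          & val I1 :|: val I2 == val J1 :|: val J2])
      ((sgnt [tuple of ord I1 ++ ord I2] [tuple of ord J1 ++ ord J2])%:~R *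
       \det (submx_tuple Y (ord I1) (ord J1))) *:
      \sum_(T : ksubset r l) \sum_(V : ksubset q l) \sum_(W : ksubset q l)
        (epst (ord J2) (ord I2) (subtuple (ord J2) (ord V)) (subtuple (ord I2) (ord W)))%:~R *:
        (\det (submx_tuple (Xmx K n r) (subtuple (ord J2) (ord V)) (ord T)) *
         \det (submx_tuple (Dmx K n r) (subtuple (ord I2) (ord W)) (ord T))).
Proof.
rewrite polmap_eval_Mop; apply: eq_bigr => l _; rewrite stirling2E.
rewrite -(@sum_minors_epst q l (q - l)); last by rewrite subnKC // -ltnS.
rewrite -!scaler_nat !scalerA; congr (_ *: _).
by rewrite -!mulrA; congr (_ * _); rewrite mulrC -!mulrA [RHS]mulrCA.
Qed.

End Main.

Theorem theorem3p12 (R : realType) (n r p q : nat)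
    (ord : forall m k, ksubset m k -> k.-tuple 'I_m) :
  is_ordering ord -> (1 <= n)%N -> (1 <= r)%N -> (p + q <= n)%N ->
  forall Y : 'M[R[i]]_n,
  polmap_eval (Mop R[i] n r p q) Y =
  \sum_(l < q.+1)
    ((-1) ^+ (q - l) * (q - l)`!%:R * l`!%:R * (stirling2 q l)%:R) *:
    \sum_(I1 : ksubset n p) \sum_(J1 : ksubset n p)
    \sum_(I2 : ksubset n q) \sum_(J2 : ksubset n q |
        [&& [disjoint val I1 & val I2], [disjoint val J1 & val J2]
          & val I1 :|: val I2 == val J1 :|: val J2])
      let tI1 := ord n p I1 in let tJ1 := ord n p J1 in
      let tI2 := ord n q I2 in let tJ2 := ord n q J2 in
      ((sgnt [tuple of tI1 ++ tI2] [tuple of tJ1 ++ tJ2])%:~R *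
       \det (submx_tuple Y tI1 tJ1)) *:
      \sum_(T : ksubset r l) \sum_(V : ksubset q l) \sum_(W : ksubset q l)
        let tT := ord r l T in
        let J2V := subtuple tJ2 (ord q l V) in
        let I2W := subtuple tI2 (ord q l W) in
        (epst tJ2 tI2 J2V I2W)%:~R *:
        (\det (submx_tuple (Xmx R[i] n r) J2V tT) *
         \det (submx_tuple (Dmx R[i] n r) I2W tT)).
Proof.
move=> ordP _ _ _ Y; exact: (polmap_eval_Mop_minors r p ordP Y q).
Qed.
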